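(* Let $\Omega\subset\mathbb{C}^n$ be a P-hyperconvex domain and let $u$ be a function on $\overline{\Omega}$ that is plurisubharmonic on $\Omega$ and upper semicontinuous on $\overline{\Omega}$. Then $u \in \mathcal{PSH}(\overline{\Omega})$ if and only if $u|_{\partial \Omega}\in \mathcal{PSH}(\partial\Omega)$.
   Context: A domain is a connected open set. Upper semicontinuous functions take values in $[-\infty,\infty)$. For a compact set $X\subset\mathbb{C}^n$ (used here for both $X=\overline{\Omega}$ and $X=\partial\Omega$): - $\mathcal{PSH}^o(X)$ is the set of functions $u$ on $X$ for which there exist an open set $U\supset X$ and a function $\tilde u$, plurisubharmonic and continuous on $U$, with $\tilde u|_X=u$. - For $z\in X$, the set $\mathcal{J}_z(X)$ of Jensen measures for $z$ is the set of all (regular Borel) probability measures $\mu$ on $X$ such that $u(z)\le\int u\,d\mu$ for all $u\in\mathcal{PSH}^o(X)$. - $\mathcal{PSH}(X)$, the set of plurisubharmonic functions on the compact set $X$, is the set of all upper semicontinuous functions $u$ on $X$ such that $u(z)\le\int u\,d\mu$ for every $z\in X$ and every $\mu\in\mathcal{J}_z(X)$. A bounded domain $\Omega\subset\mathbb{C}^n$ is called P-hyperconvex if there is a non-constant function $\phi\in\mathcal{PSH}(\overline{\Omega})\cap C(\overline{\Omega})$ such that $\phi(z)=0$ for all $z\in\partial\Omega$. *)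

(* Defs.v *)
From HB Require Import structures.
From mathcomp Require Import all_boot all_order all_algebra complex.
From mathcomp Require Import all_classical all_reals all_analysis.

Set Implicit Arguments.
Unset Strict Implicit.
Unset Printing Implicit Defensive.

Import Order.TTheory GRing.Theory Num.Theory.
Import numFieldNormedType.Exports.

Local Open Scope classical_set_scope.
Local Open Scope complex_scope.
Local Open Scope ring_scope.

(* Naming the field structure gives C and C^n the topology that the library
   attaches to every numFieldType; R[i] itself carries none. *)
Definition Cplx (R : realType) : numClosedFieldType := R[i].

Notation Cspace R n := 'rV[Cplx R]_n.

Definition boundary (T : topologicalType) (A : set T) : set T :=
  closure A `\` interior A.

(* A function on a subset D of T is the restriction to D of a total function;
   the definitions below never look at its values outside D. *)
Definition usc_on (R : realType) (T : topologicalType) (D : set T)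
    (u : T -> \bar R) : Prop :=
  forall x, D x -> (u x < +oo)%E /\
    forall a : R, (u x < a%:E)%E ->
      \forall y \near within D (nbhs x), (u y < a%:E)%E.

(* Upper semicontinuity bounds f above on the circle, so its integral is well
   defined in [-oo, +oo[. The function -oo is allowed. *)
Definition subharmonic (R : realType) (D : set (Cplx R))
    (f : Cplx R -> \bar R) : Prop :=
  usc_on D f /\
  forall (c : Cplx R) (r : R), 0 < r ->
    [set w : Cplx R | `|w - c| <= r%:C] `<=` D ->
    (f c <= ((2 * pi)^-1)%:E *
       \int[lebesgue_measure]_(t in `[0%R, (2 * pi)%R])
          f (c + ((r * cos t) +i* (r * sin t)))%R)%E.

Definition psh (R : realType) (n : nat) (U : set (Cspace R n))
    (u : Cspace R n -> \bar R) : Prop :=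
  usc_on U u /\
  forall a b : Cspace R n,
    subharmonic [set w : Cplx R | U (a + w *: b)] (fun w => u (a + w *: b)).

Definition psh_o (R : realType) (n : nat) (X : set (Cspace R n))
    (u : Cspace R n -> R) : Prop :=
  exists (U : set (Cspace R n)) (v : Cspace R n -> R),
    [/\ open U, X `<=` U, psh U (EFin \o v), {within U, continuous v}
      & forall z, X z -> v z = u z].

Definition borel_Cspace (R : realType) (n : nat) :=
  g_sigma_algebraType (@open (Cspace R n)).

Definition regular_measure (R : realType) (n : nat)
    (mu : set (borel_Cspace R n) -> \bar R) : Prop :=
  forall A : set (borel_Cspace R n), measurable A ->
    mu A = ereal_inf [set mu V |
      V in [set V | @open (Cspace R n) V /\ A `<=` V]] /\
    mu A = ereal_sup [set mu K |
      K in [set K | @compact (Cspace R n) K /\ K `<=` A]].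

(* A probability measure on the compact set X is a Borel probability measure on
   C^n that gives X full mass. *)
Definition jensen (R : realType) (n : nat) (X : set (Cspace R n))
    (z : Cspace R n) (mu : probability (borel_Cspace R n) R) : Prop :=
  [/\ regular_measure mu, mu X = 1%E
    & forall u : Cspace R n -> R, psh_o X u ->
        ((u z)%:E <= \int[mu]_(x in X) (u x)%:E)%E].

Definition psh_compact (R : realType) (n : nat) (X : set (Cspace R n))
    (u : Cspace R n -> \bar R) : Prop :=
  usc_on X u /\
  forall z, X z -> forall mu : probability (borel_Cspace R n) R,
    jensen X z mu -> (u z <= \int[mu]_(x in X) u x)%E.

Definition P_hyperconvex (R : realType) (n : nat)
    (Omega : set (Cspace R n)) : Prop :=
  [/\ open Omega, connected Omega, bounded_set Omega
    & exists phi : Cspace R n -> R,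
      [/\ psh_compact (closure Omega) (EFin \o phi),
          {within closure Omega, continuous phi},
          exists x y, [/\ closure Omega x, closure Omega y & phi x <> phi y]
        & forall z, boundary Omega z -> phi z = 0]].

(* Main.v *)
Require Import Defs.
From HB Require Import structures.
From mathcomp Require Import all_boot all_order all_algebra complex.
From mathcomp Require Import all_classical all_reals all_analysis.
From mathcomp Require Import measurable_realfun ring lra.
Import Order.TTheory GRing.Theory Num.Theory.
Import numFieldNormedType.Exports.

(** Write K for the closure of Omega and B for its boundary.

    From K to B the statement is formal: a Jensen measure for B gives full mass
    to B, hence is a Jensen measure for K, and the two integrals agree
    ([psh_compact_sub]).

    From B to K, the function u is first replaced by g = max(u, -M), and g by
    its sup-convolutions f >= g, which are Lipschitz and decrease to u when M
    and the Lipschitz constant grow. It is then enough to find, for each e > 0,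
    a function w in PSH^o(K) with g <= w <= f + 3 e: a Jensen measure mu for z
    can be tested on w, so g z <= w z <= \int w dmu <= \int f dmu + 3 e. This
    w ([psh_o_between]) is glued from three functions:
    - v in PSH^o(B) with g - e < v <= f on B, defined near B only;
    - p in PSH^o(K), uniformly close to the exhaustion phi of Omega;
    - h, a sup-convolution of g with so large a constant that h is
      plurisubharmonic away from B.
    Near B take w = max(v + 2 e + A p, h), and w = h elsewhere. As phi < 0 in
    Omega, a large A pushes the first term below h where v ceases to be
    defined; as phi = 0 on B, the first term exceeds h very close to B, where h
    is not known to be plurisubharmonic.

    The functions v and p come from Edwards' theorem ([edwards],
    [edwards_uniform]): for f continuous on a compact X, the supremum at z of
    the functions of PSH^o(X) below f is the infimum of the integrals of f
    against the Jensen measures for z. It rests on two classical facts. The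
    first is the Hahn-Banach theorem, obtained by minimizing sublinear
    functionals. It applies to all bounded functions, so its outcome, evaluated
    on indicators, is a finitely additive set function on all subsets. The
    second is the Riesz representation theorem, which that set function makes
    short: inner content by compact sets, then Caratheodory's construction.

    Two properties of plurisubharmonic functions are used. A sup-convolution of
    a bounded plurisubharmonic function is locally a supremum of its translates
    minus constants, and it is continuous; this replaces smoothing. For
    continuous functions the mean inequality on a disc follows from the one on
    small circles ([disc_mean]), which makes gluing possible; instead of
    harmonic majorants, the proof averages over the rotations by the N-th roots
    of unity and applies the maximum principle. *)

Set Implicit Arguments.
Unset Strict Implicit.
Unset Printing Implicit Defensive.

Local Open Scope classical_set_scope.
Local Open Scope complex_scope.
Local Open Scope ring_scope.

(** * Compactness and semicontinuity *)

(** Compactness in the form used throughout: if every point of K has a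
    neighbourhood that some index serves, and any two indices are dominated by
    a third, then one index serves the whole of K. The indices are compared
    through what they serve; the tails for this comparison generate the filter
    of the near-covering property. *)
Lemma compact_directed (T : topologicalType) (K : set T) (I : Type) (D : set I)
    (P : I -> T -> Prop) :
  compact K -> D !=set0 ->
  (forall i j, D i -> D j -> exists2 k, D k &
     forall x, K x -> P i x \/ P j x -> P k x) ->
  (forall x, K x -> exists2 i, D i & \forall y \near x, K y -> P i y) ->
  exists2 i, D i & forall x, K x -> P i x.
Proof.
move=> /compact_near_coveringP/near_covering_withinP cK D0 DP cov.
pose B i := [set k | D k /\ forall x, K x -> P i x -> P k x].
have FB : Filter (filter_from D B).
  apply: filter_from_filter => // i j Di Dj; have [k Dk Pk] := DP i j Di Dj.
  by exists k => // l [Dl Pl]; split; split => // x Kx Px;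
    apply: Pl => //; apply: Pk => //; [left|right].
have [|i Di Bi] := cK I (filter_from D B) P FB.
  move=> x /cov[i Di iP]; exists ([set y | K y -> P i y], B i) => /=.
    by split=> //; exists i.
  by move=> [y k]/= [iy [Dk kP]] Ky; apply: kP => //; exact: iy.
by exists i => // x Kx; apply: (Bi i) => //; split.
Qed.

(** If no point were a maximum, the sets where f < f i, for i in X, would be a
    directed open cover of X, so one of them would contain its own i. *)
Lemma compact_max (R : realType) (T : topologicalType) (X : set T) (f : T -> R) :
  compact X -> X !=set0 -> {within X, continuous f} ->
  exists2 c, X c & forall x, X x -> f x <= f c.
Proof.
move=> cX X0 /subspace_continuousP cf; apply: contrapT => nmax.
have [||c Xc fc] := @compact_directed _ X T X (fun i x => f x < f i) cX X0.
- move=> i j Xi Xj; case: (leP (f i) (f j)) => ij.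
    by exists j => // x _ [] // fx; exact: lt_le_trans ij.
  by exists i => // x _ [] // fx; exact: lt_trans ij.
- move=> x Xx; have [c Xc fxc] : exists2 c, X c & f x < f c.
    apply: contrapT => h; apply: nmax; exists x => // y Xy; rewrite leNgt.
    by apply/negP => xy; apply: h; exists y.
  by exists c => //; exact: (cf x Xx _ (lt_nbhsl fxc)).
by have := fc c Xc; rewrite ltxx.
Qed.

Lemma compact_superlevel (R : realType) (T : topologicalType) (X : set T)
    (u : T -> \bar R) (a : R) :
  compact X -> usc_on X u -> compact (X `&` [set x | (a%:E <= u x)%E]).
Proof.
move=> cX uu F PF FX; have FX' : F X by apply: filterS FX => x [].
have [x [Xx Fx]] := cX F PF FX'; exists x; split => //; split => //=.
rewrite leNgt; apply/negP => uxa.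
have [y [[Xy /= ay] /(_ Xy)/= ya]] := Fx _ _ FX ((uu x Xx).2 a uxa).
by move: ay; rewrite leNgt ya.
Qed.

Definition bounded_on (T : Type) (R : realType) (X : set T) (f : T -> R) :=
  exists K : R, forall x, X x -> `|f x| <= K.

Section bounded_on.
Variables (T : Type) (R : realType) (X : set T).

Lemma bounded_onD (f g : T -> R) :
  bounded_on X f -> bounded_on X g -> bounded_on X (f + g).
Proof.
move=> [K fK] [M gM]; exists (K + M) => x Xx.
by apply: le_trans (ler_normD _ _) _; rewrite lerD ?fK ?gM.
Qed.

Lemma bounded_onZ (t : R) (f : T -> R) : bounded_on X f -> bounded_on X (t *: f).
Proof.
move=> [K fK]; exists (`|t| * K) => x Xx.
by rewrite [(t *: f) x]/(t * f x) normrM ler_wpM2l ?fK.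
Qed.

Lemma bounded_on_cst (c : R) : bounded_on X (cst c).
Proof. by exists `|c|. Qed.

Lemma bounded_on_indic (A : set T) : bounded_on X (\1_A : T -> R).
Proof.
exists 1 => x _; rewrite indicE; case: (_ \in _); by rewrite ?normr1 ?normr0.
Qed.

End bounded_on.

Lemma continuous_compact_bounded (R : realType) (T : topologicalType)
    (X : set T) (f : T -> R) :
  compact X -> {within X, continuous f} ->
  bounded_on X f.
Proof.
move=> cX /subspace_continuousP cf.
have [||x Xx|K _ HK] := @compact_directed _ X R setT
    (fun K x => (`|f x| <= K)) cX.
- by exists 0%R.
- move=> i j _ _; exists (Order.max i j) => // x _.
  by move=> [] h; rewrite le_max h ?orbT.
- exists (`|f x| + 1) => //.
  have fx : \forall y \near f x, (`|y| < `|f x| + 1).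
    have [h1 h2] : (f x < `|f x| + 1) /\ (- (`|f x| + 1) < f x).
      by have := ler_norm (f x); have := ler_norm (- f x); rewrite normrN; split; lra.
    by apply: filterS2 (lt_nbhsl h1) (lt_nbhsr h2) => y ? ?; rewrite ltr_norml; apply/andP.
  have : nbhs x [set y | X y -> (`|f y| < `|f x| + 1)] := cf x Xx _ fx.
  move=> h; apply: filterS h => y h Xy; exact/ltW/h.
by exists K => x /HK.
Qed.

Lemma continuous_usc_on (R : realType) (T : topologicalType) (D : set T)
    (f : T -> R) :
  {within D, continuous f} -> usc_on D (EFin \o f).
Proof.
move=> /subspace_continuousP cf x Dx; split; first exact: ltry.
move=> a; rewrite lte_fin => fxa.
have fa : \forall y \near f x, y < a by exact: lt_nbhsl.
have : \forall y \near within D (nbhs x), f y < a := cf x Dx _ fa.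
by apply: filterS => y; rewrite /= lte_fin.
Qed.

Lemma continuous_at_usc_on (R : realType) (T : topologicalType) (D : set T)
    (f : T -> R) :
  (forall x, D x -> {for x, continuous f}) -> usc_on D (EFin \o f).
Proof.
move=> cf x Dx; split; first exact: ltry.
move=> a; rewrite lte_fin => fxa.
have : nbhs x [set y | f y < a] := cf x Dx _ (lt_nbhsl fxa).
by apply: filterS => y /= fya _; rewrite lte_fin.
Qed.

Lemma usc_on_sub (R : realType) (T : topologicalType) (X Y : set T) (u : T -> \bar R) :
  X `<=` Y -> usc_on Y u -> usc_on X u.
Proof.
move=> XY uu x Xx; have [u1 u2] := uu x (XY _ Xx); split=> // a /u2.
have FF : Filter (nbhs x) by exact: nbhs_filter.
by apply: (@filterS _ (nbhs x)) => y h /XY.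
Qed.

Lemma usc_bounded_above (R : realType) (T : topologicalType) (X : set T) (u : T -> \bar R) :
  compact X -> usc_on X u -> exists2 C : R, 0 <= C & forall x, X x -> (u x <= C%:E)%E.
Proof.
move=> cX uu.
have [||x Xx|C C0 uC] := @compact_directed T X R [set c | 0 <= c]
   (fun c x => (u x < c%:E)%E) cX.
- by exists 0 => /=.
- move=> i j /= i0 j0; exists (Order.max i j) => /=; first by rewrite le_max i0.
  by move=> x _ [] h; apply: (lt_le_trans h); rewrite lee_fin le_max lexx ?orbT.
- have [ux ux'] := uu x Xx.
  have [c c0 uc] : exists2 c : R, 0 <= c & (u x < c%:E)%E.
    case: (u x) ux => [r| |]// _; last by exists 0; rewrite ?ltNyr.
    exists (`|r| + 1); first by rewrite addr_ge0.
    by rewrite lte_fin; have := ler_norm r; lra.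
  by exists c => //; exact: ux'.
by exists C => // x /uC/ltW.
Qed.

Lemma continuous_max (R : realType) (T : topologicalType) (f g : T -> R) (x : T) :
  {for x, continuous f} -> {for x, continuous g} ->
  {for x, continuous (fun x => Order.max (f x) (g x))}.
Proof.
move=> cf cg; have -> : (fun x => Order.max (f x) (g x)) =
    (fun x => (f x + g x + `|f x - g x|) / 2).
  apply/funext => y; have [fg|gf] := leP (f y) (g y).
    by rewrite ler0_norm ?subr_le0//; lra.
  by rewrite gtr0_norm ?subr_gt0//; lra.
apply: cvgMr_tmp; apply: cvgD; first exact: (cvgD cf cg).
exact: (cvg_norm (cvgB cf cg)).
Qed.

Lemma continuous_sum (R : realType) (T : topologicalType) (I : finType)
    (g : I -> T -> R) :
  (forall i, continuous (g i)) -> continuous (fun t => \sum_i g i t).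
Proof.
move=> cg; rewrite (_ : (fun t => _) = \sum_i g i); last first.
  by apply/funext => t; rewrite fct_sumE.
elim/big_ind : _ => [t|f h cf ch t|i _]; last exact: cg.
  exact: cvg_cst.
by apply: cvgD; [exact: cf|exact: ch].
Qed.

(** * Linear functionals below a sublinear one *)

Section hahn_banach.
Variables (R : realType) (V : lmodType R) (D : set V).
Hypotheses (D0 : D 0) (DD : forall f g, D f -> D g -> D (f + g))
  (DZ : forall (t : R) f, D f -> D (t *: f)).
Implicit Types (p : V -> R) (f g : V) (t : R).

Definition sublinear_on (q : V -> R) :=
  (forall f g, D f -> D g -> q (f + g) <= q f + q g) /\
  (forall t f, 0 <= t -> D f -> q (t *: f) <= t * q f).

Let DN f : D f -> D (- f).
Proof. by rewrite -scaleN1r => ?; exact: DZ. Qed.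

Lemma sublinear0 (q : V -> R) : sublinear_on q -> q 0 = 0.
Proof.
move=> [qD qZ]; apply/eqP; rewrite eq_le; apply/andP; split.
  by have := qZ 0 0 (lexx _) D0; rewrite scale0r mul0r.
by have := qD 0 0 D0 D0; rewrite addr0; lra.
Qed.

Lemma sublinearZ (q : V -> R) t f : sublinear_on q -> 0 <= t -> D f -> q (t *: f) = t * q f.
Proof.
move=> sq; rewrite le_eqVlt => /predU1P[<- _|t0 Df].
  by rewrite scale0r mul0r sublinear0.
apply/eqP; rewrite eq_le (sq.2 _ _ (ltW t0) Df)/=.
have := sq.2 t^-1 _ (ltW _) (DZ t Df).
rewrite invr_gt0 => /(_ t0); rewrite scalerA mulVf ?gt_eqF// scale1r.
by rewrite -(ler_pM2l t0) mulrA mulfV ?gt_eqF// mul1r.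
Qed.

Lemma sublinearN (q : V -> R) f : sublinear_on q -> D f -> - q (- f) <= q f.
Proof.
move=> sq Df; have := sq.1 _ _ Df (DN Df); rewrite subrr (sublinear0 sq); lra.
Qed.

(** Among the sublinear functionals below q, the largest one whose value at - g
    is - q g. *)
Definition deflate (q : V -> R) g f := inf [set q (f + t *: g) - t * q g | t in [set t | 0 <= t]].

Section deflate.
Variables (q : V -> R) (g : V).
Hypotheses (sq : sublinear_on q) (Dg : D g).

Let nonempty f : [set q (f + t *: g) - t * q g | t in [set t | 0 <= t]] !=set0.
Proof. by exists (q (f + 0 *: g) - 0 * q g), 0 => //=. Qed.

Let lbounded f : D f ->
  lbound [set q (f + t *: g) - t * q g | t in [set t | 0 <= t]] (- q (- f)).
Proof.
move=> Df _ [t /= t0 <-]; rewrite -(sublinearZ sq t0 Dg).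
have := sq.1 (f + t *: g) (- f) (DD Df (DZ t Dg)) (DN Df).
rewrite addrAC subrr add0r; lra.
Qed.

Lemma deflate_le f t : D f -> 0 <= t -> deflate q g f <= q (f + t *: g) - t * q g.
Proof.
by move=> Df t0; apply: ge_inf; [exists (- q (- f)); exact: lbounded|exists t].
Qed.

Lemma deflate_sublinear : sublinear_on (deflate q g).
Proof.
split=> [f h Df Dh|t f t0 Df].
  rewrite -lerBlDr; apply: lb_le_inf => // _ [t /= t0 <-].
  rewrite lerBlDr -lerBlDl; apply: lb_le_inf => // _ [s /= s0 <-].
  rewrite lerBlDl; have := deflate_le (DD Df Dh) (addr_ge0 s0 t0).
  have := sq.1 _ _ (DD Df (DZ t Dg)) (DD Dh (DZ s Dg)).
  by rewrite addrACA -scalerDl (addrC t s); lra.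
move: t0; rewrite le_eqVlt => /predU1P[<-|t0].
  rewrite scale0r mul0r; have := deflate_le D0 (lexx 0).
  by rewrite scale0r mul0r addr0 (sublinear0 sq) subr0.
rewrite -ler_pdivrMl//; apply: lb_le_inf => // _ [s /= s0 <-].
rewrite ler_pdivrMl//; have := deflate_le (DZ t Df) (mulr_ge0 (ltW t0) s0).
rewrite -scalerA -scalerDr (sublinearZ sq (ltW t0) (DD Df (DZ s Dg))).
by rewrite mulrBr mulrA.
Qed.

End deflate.

(** A sublinear functional q that is minimal for the pointwise order is linear:
    deflating it in a direction g changes nothing, and this says that
    q (f + g) >= q f + q g. Zorn's lemma provides a minimal functional below
    the deflation of p in the direction f0, which forces L f0 = p f0.
    Everything is relative to a subspace D, so that the bounded functions on a
    set can be treated inside the space of all functions. *)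
Theorem hahn_banach p f0 : sublinear_on p -> D f0 ->
  exists L : V -> R,
    [/\ forall f g, D f -> D g -> L (f + g) = L f + L g,
        forall t f, D f -> L (t *: f) = t * L f,
        forall f, D f -> L f <= p f
      & L f0 = p f0].
Proof.
move=> sp Df0; set p0 := deflate p f0.
have sp0 : sublinear_on p0 by exact: deflate_sublinear.
pose S := {q : V -> R | sublinear_on q /\ forall f, D f -> q f <= p0 f}.
pose below (q r : S) := `[< forall f, D f -> sval r f <= sval q f >].
have Sp0 : S by exists p0.
have /(ZL_preorder Sp0) [] : forall r, below r r by move=> q; apply/asboolP.
- move=> q r s /asboolP qr /asboolP rs; apply/asboolP => f Df.
  exact: le_trans (rs f Df) (qr f Df).
- move=> A totA; have [->|/set0P[q0 Aq0]] := eqVneq A set0.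
    by exists Sp0 => q.
  pose E f := [set sval q f | q in A].
  have E0 f : E f !=set0 by exists (sval q0 f), q0.
  have lbE f : D f -> lbound (E f) (- p0 (- f)).
    move=> Df _ [[q [sq qp]] Aq <-] /=.
    by apply: le_trans (sublinearN sq Df); rewrite lerN2 qp//; exact: DN.
  have infE q f : D f -> A q -> inf (E f) <= sval q f.
    by move=> Df Aq; apply: ge_inf; [exists (- p0 (- f)); exact: lbE|exists q].
  (* An infimum of sublinear functionals is sublinear along a chain: two members
     can be replaced by the smaller of them. *)
  have si : sublinear_on (fun f => inf (E f)).
    split=> [f g Df Dg|t f t0 Df].
      rewrite -lerBlDr; apply: lb_le_inf => // _ [q Aq <-].
      rewrite lerBlDr -lerBlDl; apply: lb_le_inf => // _ [r Ar <-].
      rewrite lerBlDl.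
      have [/asboolP qr|/asboolP rq] := totA _ _ Aq Ar.
        have := infE _ _ (DD Df Dg) Ar; have := (svalP r).1.1 _ _ Df Dg.
        by have := qr _ Df; lra.
      have := infE _ _ (DD Df Dg) Aq; have := (svalP q).1.1 _ _ Df Dg.
      by have := rq _ Dg; lra.
    move: t0; rewrite le_eqVlt => /predU1P[<-|t0].
      rewrite scale0r mul0r; have := infE _ _ D0 Aq0.
      by rewrite (sublinear0 (svalP q0).1).
    rewrite -ler_pdivrMl//; apply: lb_le_inf => // _ [q Aq <-].
    rewrite ler_pdivrMl//; have := infE _ _ (DZ t Df) Aq.
    by rewrite (sublinearZ (svalP q).1 (ltW t0) Df).
  have ip f : D f -> inf (E f) <= p0 f.
    by move=> Df; apply: le_trans (infE _ _ Df Aq0) _; exact: (svalP q0).2.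
  exists (exist _ _ (conj si ip) : S) => q Aq.
  by apply/asboolP => f Df /=; exact: infE.
move=> [q [sq qp0]] qmin.
have qD f g : D f -> D g -> q (f + g) = q f + q g.
  move=> Df Dg; apply/eqP; rewrite eq_le (sq.1 _ _ Df Dg)/=.
  have dq h : D h -> deflate q g h <= q h.
    by move=> Dh; have := deflate_le sq Dg Dh (lexx 0); rewrite scale0r mul0r addr0 subr0.
  have dp h : D h -> deflate q g h <= p0 h.
    by move=> Dh; apply: le_trans (dq _ Dh) (qp0 _ Dh).
  have /= := qmin (exist _ _ (conj (deflate_sublinear sq Dg) dp) : S).
  have bq : below (exist _ q (conj sq qp0) : S)
      (exist _ _ (conj (deflate_sublinear sq Dg) dp) : S).
    by apply/asboolP.
  move=> /(_ bq)/asboolP/(_ _ Df)/= h.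
  by have := deflate_le sq Dg Df ler01; rewrite scale1r mul1r; lra.
have qN f : D f -> q (- f) = - q f.
  by move=> Df; have := qD _ _ Df (DN Df); rewrite subrr (sublinear0 sq); lra.
have p0p f : D f -> p0 f <= p f.
  by move=> Df; have := deflate_le sp Df0 Df (lexx 0); rewrite scale0r mul0r addr0 subr0.
exists q; split => //.
- move=> t f Df; have [t0|t0] := leP 0 t; first exact: sublinearZ.
  by rewrite -[t]opprK scaleNr qN ?sublinearZ ?mulNr ?oppr_ge0 ?ltW//; exact: DZ.
- by move=> f Df; exact: le_trans (qp0 _ Df) (p0p _ Df).
- apply/eqP; rewrite eq_le (le_trans (qp0 _ Df0) (p0p _ Df0))/=.
  have := deflate_le sp Df0 (DN Df0) ler01.
  rewrite scale1r mul1r addNr (sublinear0 sp).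
  have := qp0 _ (DN Df0); rewrite qN// -/p0; lra.
Qed.

End hahn_banach.

(** * A Borel measure from a finitely additive set function *)

Section riesz.
Variables (R : realType) (T : puniformType) (m : set T -> R) (X : set T).
Hypotheses (hT : hausdorff_space T) (cX : compact X)
  (m_ge0 : forall A, 0 <= m A)
  (mU : forall A B, A `&` B = set0 -> m (A `|` B) = m A + m B)
  (mX : m X = 1) (mXC : m (~` X) = 0).

(** In place of a partition of unity: by regularity of the topology, the part
    of C outside U is covered by some open N with closure inside V. *)
Lemma compact_split (C V U : set T) : compact C -> open V -> open U ->
  C `<=` V `|` U ->
  exists C1 C2, [/\ compact C1, compact C2, C = C1 `|` C2, C1 `<=` V & C2 `<=` U].
Proof.
move=> cC oV oU CVU.
have [||x Cx|N [oN NV] CN] := @compact_directed _ C _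
    [set N : set T | open N /\ closure N `<=` V] (fun N x => N x \/ U x) cC.
- by exists set0; split; [exact: open0|rewrite closure0].
- move=> M N [oM MV] [oN NV]; exists (M `|` N).
    by split; [exact: openU|rewrite closureU => x [/MV|/NV]].
  by move=> x _ [[]|[]]; [left; left|right|left; right|right].
- have [Vx|Ux] := CVU _ Cx; last first.
    exists set0; first by split; [exact: open0|rewrite closure0].
    by apply: filterS (open_nbhs_nbhs (conj oU Ux)) => y; right.
  have [N Nx NV] := uniform_regular (open_nbhs_nbhs (conj oV Vx)).
  exists N°; first split; first exact: open_interior.
    by apply: subset_trans NV; apply: closure_subset; exact: interior_subset.
  by apply: filterS (nbhs_interior Nx) => y ? _; left.
exists (C `&` closure N), (C `\` N); split.
- by apply: compact_closedI => //; exact: closed_closure.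
- by apply: compact_closedI => //; exact: open_closedC.
- apply/seteqP; split=> x; last by move=> [[]|[]].
  by move=> Cx; have [/subset_closure Nx|nNx] := pselect (N x); [left|right].
- by move=> x [_ /NV].
- by move=> x [/CN[]].
Qed.

Let m0 : m set0 = 0.
Proof. by have := mU (setI0 set0); rewrite setU0; lra. Qed.

Let le_m A B : A `<=` B -> m A <= m B.
Proof.
move=> AB; rewrite -(setDUK AB) mU ?lerDl//; exact: setDIK.
Qed.

Let m_le1 A : m A <= 1.
Proof.
have <- : m setT = 1 by rewrite -(setUv X) mU ?setICr// mX mXC addr0.
exact: le_m.
Qed.

Let m_leU A B : m (A `|` B) <= m A + m B.
Proof.
rewrite -(setDUK (@subsetUl _ A B)) mU; last exact: setDIK.
by rewrite lerD2l; apply: le_m => x [[]].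
Qed.

Local Open Scope ereal_scope.

(** The value m C of a compact set is kept only as a lower bound for the open
    sets around C: m is finitely additive but it need not be regular or
    countably additive. *)
Definition inner_content (U : set T) : \bar R :=
  ereal_sup [set (m C)%:E | C in [set C | compact C /\ C `<=` U]].

Definition outer_content (A : set T) : \bar R :=
  ereal_inf [set inner_content U | U in [set U | open U /\ A `<=` U]].

Let inner_ub U C : compact C -> C `<=` U -> (m C)%:E <= inner_content U.
Proof. by move=> cC CU; apply: ereal_sup_ubound; exists C. Qed.

Let inner_ge0 U : 0 <= inner_content U.
Proof.
have <- : (m set0)%:E = 0 by rewrite m0.
by apply: inner_ub => //; exact: compact0.
Qed.

Let inner_le1 U : inner_content U <= 1.
Proof. by apply: ge_ereal_sup => _ [C _ <-]; rewrite lee_fin m_le1. Qed.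

Let le_inner U V : U `<=` V -> inner_content U <= inner_content V.
Proof.
move=> UV; apply: ge_ereal_sup => _ [C [cC CU] <-].
by apply: inner_ub => //; exact: subset_trans UV.
Qed.

Let outer_lb A U : open U -> A `<=` U -> outer_content A <= inner_content U.
Proof. by move=> oU AU; apply: ereal_inf_lbound; exists U. Qed.

Let outer_open U : open U -> outer_content U = inner_content U.
Proof.
move=> oU; apply/eqP; rewrite eq_le outer_lb//=.
by apply: le_ereal_inf_tmp => _ [V [oV UV] <-]; exact: le_inner.
Qed.

Let le_outer A B : A `<=` B -> outer_content A <= outer_content B.
Proof.
move=> AB; apply: le_ereal_inf_tmp => _ [V [oV UV] <-].
by apply: outer_lb => //; exact: subset_trans UV.
Qed.

Let outer_ge0 A : 0 <= outer_content A.
Proof. by apply: le_ereal_inf_tmp => _ [V [oV UV] <-]. Qed.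

Let outer_le1 A : outer_content A <= 1.
Proof. by apply: le_trans (outer_lb openT (@subsetT _ A)) _. Qed.

Let outer0 : outer_content set0 = 0.
Proof.
rewrite (outer_open open0); apply/eqP; rewrite eq_le inner_ge0 andbT.
by apply: ge_ereal_sup => _ [C [_ C0] <-]; move: C0; rewrite subset0 => ->; rewrite m0.
Qed.

Let m_le_outer C : compact C -> (m C)%:E <= outer_content C.
Proof. by move=> cC; apply: le_ereal_inf_tmp => _ [V [oV CV] <-]; exact: inner_ub. Qed.

(** Splitting C along the cover reduces countable subadditivity to finite
    additivity of m. *)
Let m_finite_cover (U : nat -> set T) k C : (forall i, open (U i)) -> compact C ->
  C `<=` \big[setU/set0]_(i < k) U i ->
  (m C)%:E <= \sum_(i < k) inner_content (U i).
Proof.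
move=> oU; elim: k C => [|k IH] C cC.
  by rewrite !big_ord0 subset0 => ->; rewrite m0.
rewrite !big_ord_recr/= => CU.
have oUk : open (\big[setU/set0]_(i < k) U i).
  by elim/big_ind : _ => //; [exact: open0|exact: openU].
have [C1 [C2 [cC1 cC2 -> C1U C2U]]] := compact_split cC oUk (oU k) CU.
apply: (@le_trans _ _ ((m C1)%:E + (m C2)%:E)).
  by rewrite -EFinD lee_fin m_leU.
by apply: leeD; [exact: IH|exact: inner_ub].
Qed.

Let inner_sigma_subadditive (U : nat -> set T) : (forall i, open (U i)) ->
  inner_content (\bigcup_i U i) <= \sum_(i <oo) inner_content (U i).
Proof.
move=> oU; apply: ge_ereal_sup => _ [C [cC CU] <-].
have [||x Cx|k _ Ck] := @compact_directed _ C nat setT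
    (fun k x => (\big[setU/set0]_(i < k) U i) x) cC.
- by exists 0%N.
- move=> i j _ _; exists (maxn i j) => // x _.
  have le_big a b : (a <= b)%N ->
      \big[setU/set0]_(i < a) U i `<=` \big[setU/set0]_(i < b) U i.
    exact: subset_bigsetU.
  by move=> []; [apply: (le_big i)|apply: (le_big j)];
    rewrite ?leq_maxl ?leq_maxr.
- have [k _ Ukx] := CU _ Cx; exists k.+1 => //.
  apply: filterS (open_nbhs_nbhs (conj (oU k) Ukx)) => y Uy _.
  by rewrite big_ord_recr/=; right.
apply: (le_trans (m_finite_cover oU cC Ck)).
rewrite -(big_mkord xpredT (inner_content \o U)); by apply: nneseries_lim_ge => *; exact: inner_ge0.
Qed.

Let outer_approx A (e : R) : (0 < e)%R ->
  exists U, [/\ open U, A `<=` U & inner_content U <= outer_content A + e%:E].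
Proof.
move=> e0; have : outer_content A \is a fin_num.
  by rewrite ge0_fin_numE// (le_lt_trans (outer_le1 A))// ltry.
move=> /(lb_ereal_inf_adherent e0)[_ [U [oU AU] <-] /ltW h].
by exists U.
Qed.

Let outer_sigma_subadditive : sigma_subadditive outer_content.
Proof.
move=> A; apply/lee_addgt0Pr => e e0.
rewrite (le_trans _ (epsilon_trick xpredT _ (ltW e0)))//.
have /choice[U PU] : forall n, exists U, [/\ open U, A n `<=` U &
    inner_content U <= outer_content (A n) + (e / (2 ^ n.+1)%:R)%:E].
  by move=> n; apply: outer_approx; rewrite divr_gt0// ltr0n expn_gt0.
apply: (@le_trans _ _ (inner_content (\bigcup_i U i))).
  apply: outer_lb; first by apply: bigcup_open => i _; case: (PU i).
  by apply: subset_bigcup => i _; case: (PU i).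
apply: (le_trans (inner_sigma_subadditive _)); first by move=> i; case: (PU i).
by apply: lee_nneseries => // i _ ; case: (PU i).
Qed.

Let outer : {outer_measure set T -> \bar R} :=
  HB.pack_for {outer_measure set T -> \bar R} outer_content
    (isOuterMeasure.Build R T outer_content outer0 outer_ge0 le_outer
       outer_sigma_subadditive).

(** Let V be open and C be compact in V :&: U with almost maximal m-measure.
    What V has outside U lies in V minus C, and a compact set there is disjoint
    from C, so that m adds up their measures inside V. *)
Let open_caratheodory (U : set T) : open U -> outer.-caratheodory U.
Proof.
move=> oU; apply: le_caratheodory_measurable => A /=.
apply: le_ereal_inf_tmp => _ [V [oV AV] <-].
apply/lee_addgt0Pr => e e0.
have e20 : (0 < e / 2)%R by rewrite divr_gt0.
have ifin W : inner_content W \is a fin_num.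
  by rewrite ge0_fin_numE// (le_lt_trans (inner_le1 W))// ltry.
have [_ [C [cC CVU] <-]] := ub_ereal_sup_adherent e20 (ifin (V `&` U)).
have [_ [D [cD DVC] <-]] := ub_ereal_sup_adherent e20 (ifin (V `\` C)).
rewrite !lteBlDr// => hD hC.
have oVC : open (V `\` C).
  by rewrite setDE; apply: openI => //; apply: closed_openC; exact: compact_closed.
have CD0 : C `&` D = set0.
  by apply/seteqP; split=> x // [Cx /DVC[_]].
have mCD : (m C)%:E + (m D)%:E <= inner_content V.
  rewrite -EFinD -mU//; apply: inner_ub; first exact: compactU.
  by move=> x [/CVU[]|/DVC[]].
apply: (@le_trans _ _ (inner_content (V `&` U) + inner_content (V `\` C))).
  apply: leeD; apply: outer_lb => //; first exact: openI.
    by apply: setSI.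
  by move=> x [/AV Vx nUx]; split=> // /CVU[].
apply: (le_trans (leeD (ltW hC) (ltW hD))).
rewrite addeACA -(EFinD (e / 2)) -splitr; exact: leeD.
Qed.

Let borel_caratheodory (A : set (g_sigma_algebraType (@open T))) :
  measurable A -> outer.-caratheodory A.
Proof.
apply: smallest_sub; last exact: open_caratheodory.
split.
- exact: caratheodory_measurable_set0.
- by move=> B; rewrite setTD; exact: caratheodory_measurable_setC.
- exact: caratheodory_measurable_bigcup.
Qed.

Let outer_semi_sigma_additive :
  semi_sigma_additive (outer_content : set (g_sigma_algebraType (@open T)) -> _).
Proof.
move=> F mF tF mUF.
apply: (@caratheodory_measure_sigma_additive _ _ outer) => //.
  by move=> i; exact: borel_caratheodory.
exact: borel_caratheodory.
Qed.

Let outerX : outer_content X = 1.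
Proof. by apply/eqP; rewrite eq_le outer_le1 -mX m_le_outer. Qed.

Let outerT : outer_content setT = 1.
Proof. by apply/eqP; rewrite eq_le outer_le1 -outerX le_outer. Qed.

(** The measure P dominates m on compact sets, because every open set around C
    has inner content at least m C. Inner regularity follows from outer
    regularity by taking complements in the compact set X. *)
Theorem riesz_measure : exists P : probability (g_sigma_algebraType (@open T)) R,
  [/\ P X = 1, forall C, compact C -> (m C)%:E <= P C,
      (forall A, measurable A -> P A = ereal_inf [set P V |
         V in [set V : set T | open V /\ A `<=` V]])
    & forall A, measurable A -> P A = ereal_sup [set P K |
         K in [set K : set T | compact K /\ K `<=` A]]].
Proof.
pose m1 := isMeasure.Build _ (g_sigma_algebraType (@open T)) R outer_content
  outer0 outer_ge0 outer_semi_sigma_additive.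
pose P0 : {measure set (g_sigma_algebraType (@open T)) -> \bar R} :=
  HB.pack_for {measure set (g_sigma_algebraType (@open T)) -> \bar R}
   outer_content m1.
pose m2 := Measure_isProbability.Build _ _ _ P0 outerT.
pose P : probability (g_sigma_algebraType (@open T)) R :=
  HB.pack_for (probability (g_sigma_algebraType (@open T)) R) outer_content m1 m2.
have outreg A : P A = ereal_inf [set P V |
         V in [set V : set T | open V /\ A `<=` V]].
  have PE V : P V = outer_content V by [].
  rewrite PE {1}/outer_content; congr ereal_inf; apply/seteqP.
  by split=> _ [V [oV AV] <-]; exists V => //; rewrite PE outer_open.
exists P; split => //.
move=> A mA; apply/eqP; rewrite eq_le; apply/andP; split; last first.
  apply: ge_ereal_sup => _ [K [cK KA] <-]; exact: le_outer.
apply/lee_addgt0Pr => e e0.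
have [U [oU AU PU]] := outer_approx (~` A) e0.
have cXU : compact (X `\` U).
  by apply: compact_closedI => //; exact: open_closedC.
have XUA : X `\` U `<=` A.
  by move=> x [_ nUx]; apply: contrapT => /AU.
apply: (@le_trans _ _ (P (X `\` U) + e%:E)); last first.
  by rewrite leeD2r//; apply: ereal_sup_ubound; exists (X `\` U).
have : P setT <= P (X `\` U) + P U.
  rewrite probability_setT -outerX.
  apply: le_trans (outer_measureU2 outer _ _).
  by apply: le_outer => x Xx; have [?|?] := pselect (U x); [right|left].
have : P U <= P (~` A) + e%:E by apply: le_trans PU; exact: outer_lb.
rewrite probability_setT (probability_setC P mA).
have [fA fU fXU] : [/\ P A \is a fin_num, P U \is a fin_num & P (X `\` U) \is a fin_num].
  by split; rewrite ge0_fin_numE ?outer_ge0// (le_lt_trans (outer_le1 _)) ?ltry.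
rewrite -(fineK fA) -(fineK fU) -(fineK fXU) -!EFinD !lee_fin => ? ?; lra.
Qed.

End riesz.

(** * Integrals against Borel probabilities *)

Section integral.
Local Open Scope ereal_scope.

(** The integral is a difference of suprema over simple functions, hence it is
    monotone on arbitrary functions. This is what allows u on circles, and its
    majorants, to be compared without any measurability argument. *)
Lemma le_integral_pointwise d (T : measurableType d) (R : realType)
    (mu : {measure set T -> \bar R}) (D : set T) (f g : T -> \bar R) :
  (forall x, D x -> f x <= g x) ->
  \int[mu]_(x in D) f x <= \int[mu]_(x in D) g x.
Proof.
move=> fg; have fgD x : (f \_ D) x <= (g \_ D) x.
  by rewrite !patchE; case: ifPn => // /set_mem /fg.
rewrite /integral; apply: leeB; apply: ge_ereal_sup => _ [h hle <-];
  apply: ereal_sup_ubound; exists h => // x; apply: (le_trans (hle x)).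
  by rewrite !funeposE ge_max !le_max fgD lexx orbT.
by rewrite !funenegE ge_max !le_max lexx orbT andbT leeN2 fgD.
Qed.

Lemma integral_full_measure d (T : measurableType d) (R : realType)
    (P : probability T R) (X Y : set T) (u : T -> \bar R) :
  measurable X -> measurable Y -> X `<=` Y -> P X = 1 -> measurable_fun Y u ->
  \int[P]_(x in Y) u x = \int[P]_(x in X) u x.
Proof.
move=> mX mY XY PX mu.
have mYX : measurable (Y `\` X) by exact: measurableD.
have PYX : P (Y `\` X) = 0.
  apply/eqP; rewrite eq_le measure_ge0 andbT.
  have : P (Y `\` X) <= P (~` X) by rewrite setDE; apply: le_measure;
    rewrite ?inE; [rewrite -setDE|exact: measurableC|exact: subIsetr].
  by rewrite probability_setC// PX subee.
rewrite -{1}(setDUK XY) integral_setU//.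
- rewrite [X in _ + X]null_set_integral ?adde0//.
  exact: measurable_funS mu.
- by rewrite setDUK.
- by rewrite disj_set2E setDIK.
Qed.

Lemma integral_prob_cst d (T : measurableType d) (R : realType)
    (P : probability T R) (X : set T) (c : R) :
  measurable X -> P X = 1 -> \int[P]_(x in X) c%:E = c%:E.
Proof. by move=> mX PX; rewrite (integral_cst P mX c%:E) [X in _ * X]PX mule1. Qed.

(** Monotone convergence for the nonnegative functions f 0 - f k. The limit u
    may take the value -oo; the bound a is what shows that f 0 - u is
    integrable. *)
Lemma le_integral_decreasing d (T : measurableType d) (R : realType)
    (P : probability T R) (X : set T) (u : T -> \bar R) (f : nat -> T -> R)
    (a : \bar R) :
  measurable X -> P X = 1 -> measurable_fun X u ->
  (forall k, P.-integrable X (EFin \o f k)) ->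
  (forall x, X x -> {homo f ^~ x : i j / (i <= j)%N >-> (j <= i)%R}) ->
  (forall x, X x -> (f k x)%:E @[k --> \oo] --> u x) ->
  (forall k, a <= \int[P]_(x in X) (f k x)%:E) ->
  a <= \int[P]_(x in X) u x.
Proof.
move=> mX PX mu fi df fu af.
have mf k : measurable_fun X (EFin \o f k) by have /integrableP[] := fi k.
have fin k : \int[P]_(x in X) (f k x)%:E \is a fin_num by apply: integrable_fin_num (fi k).
case: a af => [a| |] af; last by rewrite leNye.
  2: by have := af 0%N; rewrite leye_eq => /eqP h; have := fin 0%N; rewrite h.
pose g k := (EFin \o f 0%N) \- (EFin \o f k).
have mg k : measurable_fun X (g k) by exact: emeasurable_funB.
have g0 k x : X x -> 0 <= g k x.
  by move=> Xx; rewrite /g/= -EFinB lee_fin subr_ge0 df.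
have ndg x : X x -> nondecreasing_seq (g ^~ x).
  by move=> Xx i j ij; rewrite /g/= -!EFinB lee_fin lerB// df.
have glim x : X x -> g ^~ x @ \oo --> (f 0%N x)%:E - u x.
  move=> Xx; apply: cvgeB; [by rewrite fin_num_adde_defr|exact: cvg_cst|exact: fu].
have gint k : \int[P]_(x in X) g k x <= \int[P]_(x in X) (f 0%N x)%:E - a%:E.
  by rewrite /g integralB//; apply: leeB => //; exact: af.
have gu : \int[P]_(x in X) ((f 0%N x)%:E - u x) <= \int[P]_(x in X) (f 0%N x)%:E - a%:E.
  have := cvg_monotone_convergence (mu := P) mX mg g0 ndg.
  rewrite (eq_integral (fun x => (f 0%N x)%:E - u x)); last first.
    by move=> x /set_mem Xx; apply/cvg_lim => //; exact: glim.
  move=> h; rewrite -(cvg_lim _ h)//; apply: lime_le.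
    by apply/cvg_ex; eexists; exact: h.
  exact: nearW.
have mfu : measurable_fun X (fun x => (f 0%N x)%:E - u x)
  by exact: (emeasurable_funB (mf 0%N) mu).
have fu0 x : X x -> 0 <= (f 0%N x)%:E - u x.
  move=> Xx; rewrite -(cvg_lim _ (glim _ Xx))//; apply: lime_ge.
    by apply/cvg_ex; eexists; exact: glim.
  by apply: nearW => k; exact: g0.
have ifu : P.-integrable X (fun x => (f 0%N x)%:E - u x).
  apply/integrableP; split => //.
  under eq_integral => x /set_mem Xx do rewrite gee0_abs ?fu0//.
  apply: le_lt_trans gu _.
  by rewrite -(fineK (fin 0%N)) -EFinB ltry.
rewrite (eq_integral (fun x => (f 0%N x)%:E - ((f 0%N x)%:E - u x))); last first.
  by move=> x _; case: (u x) => [r| |]//=; rewrite -!EFinB; congr EFin; ring.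
have i0 : P.-integrable X (fun x => (f 0%N x)%:E) := fi 0%N.
rewrite (integralB mX i0 ifu).
by rewrite lee_suber_addl// -lee_suber_addr.
Qed.

Section borel.
Variables (R : realType) (T : puniformType).
Let B := g_sigma_algebraType (@open T).

Lemma usc_on_measurable (D : set T) (u : T -> \bar R) :
  measurable (D : set B) -> usc_on D u -> measurable_fun (D : set B) u.
Proof.
move=> mD uu; apply: (measurability _ (ErealGenInftyO.measurableE R)).
move=> /= _ [_ [a ->] <-].
rewrite (_ : _ `&` _ = D `&` [set y | D y -> u y < a%:E]°); last first.
  apply/seteqP; split=> [x [Dx]|x [Dx /interior_subset/= /(_ Dx) uxa]].
    rewrite /= in_itv/= => uxa; split => //.
    exact: (uu x Dx).2.
  by split=> //=; rewrite in_itv.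
by apply: measurableI => //; apply: sub_sigma_algebra; exact: open_interior.
Qed.

Lemma compact_borel (X : set T) : hausdorff_space T -> compact X ->
  measurable (X : set B).
Proof.
move=> hT cX; rewrite -[X]setCK; apply: measurableC.
by apply: sub_sigma_algebra; apply: closed_openC; exact: compact_closed.
Qed.

Lemma continuous_compact_integrable_prob (P : probability B R) (X : set T)
    (f : T -> R) :
  hausdorff_space T -> compact X -> P X = 1 -> {within X, continuous f} ->
  P.-integrable X (EFin \o f).
Proof.
move=> hT cX PX cf; have mX := compact_borel hT cX.
have [K fK] := continuous_compact_bounded cX cf.
apply: measurable_bounded_integrable => //.
- by rewrite [X in X < _]PX ltry.
- by apply/measurable_EFinP; apply: usc_on_measurable => //; exact: continuous_usc_on.
- exists K; split; first exact: num_real.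
  by move=> M KM x /fK fxK; apply: le_trans fxK (ltW KM).
Qed.

End borel.

End integral.

(** * Representation of positive functionals *)

(** The sum counts the integers between 1 and n that are at most y, so it is the
    integer part of y when y <= n. *)
Lemma layer_cake_bounds (R : realType) (y : R) n : 0 <= y ->
  let s := \sum_(k < n) (k.+1%:R <= y)%R%:R in
  s <= y /\ (y <= n%:R -> y <= s + 1 :> R).
Proof.
move=> y0 s; suff : [/\ s <= y, s <= n%:R & n%:R <= s \/ y <= s + 1].
  by move=> [sy sn []] h; split=> //; lra.
rewrite {}/s; elim: n => [|n [IH1 IH2 IH3]].
  by rewrite big_ord0; split => //; left.
rewrite big_ord_recr/= -[n.+1%:R]natr1; move: IH1 IH2 IH3.
set s := \sum_(_ < _) _ => IH1 IH2 IH3.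
case: (leP (n%:R + 1) y) => h /=; rewrite ?addr0.
  by split; [lra|lra|case: IH3 => ?; [left|right]; lra].
by split; [lra|lra|right; case: IH3 => ?; lra].
Qed.

Section riesz_domination.
Variables (R : realType) (T : puniformType) (X : set T) (L : (T -> R) -> R).
Hypotheses (hT : hausdorff_space T) (cX : compact X).
Hypotheses
  (LD : forall f g, bounded_on X f -> bounded_on X g -> L (f + g) = L f + L g)
  (LZ : forall t f, bounded_on X f -> L (t *: f) = t * L f)
  (L_ge0 : forall f, bounded_on X f -> (forall x, X x -> 0 <= f x) -> 0 <= L f)
  (L1 : L (cst 1) = 1).

Let L_cst c : L (cst c) = c.
Proof.
have -> : cst c = c *: (cst 1 : T -> R).
  by apply/funext => x; rewrite -[RHS]/(c * 1) mulr1.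
by rewrite LZ ?L1 ?mulr1//; exact: bounded_on_cst.
Qed.

Let L_le f g : bounded_on X f -> bounded_on X g ->
  (forall x, X x -> f x <= g x) -> L f <= L g.
Proof.
move=> bf bg fg; have bN : bounded_on X ((-1) *: f) by exact: bounded_onZ.
have := L_ge0 (bounded_onD bg bN); rewrite LD// LZ//.
have h x : X x -> 0 <= (g + (-1) *: f) x.
  by move=> Xx; rewrite -[X in 0 <= X]/(g x + (-1) * f x) mulN1r subr_ge0 fg.
by move=> /(_ h); lra.
Qed.

Let m (A : set T) : R := L \1_A.

(** For f >= 0 compare f with the number of the levels 1, 2, ... below it: this
    sum of indicators of compact sets is at distance at most 1 from f, and the
    measure dominates L on each of them. Applied to multiples of f, the error 1
    becomes arbitrarily small. Applied to - f as well, the inequality is an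
    equality. *)
Theorem riesz_domination :
  exists P : probability (g_sigma_algebraType (@open T)) R,
  [/\ P X = 1%E,
      (forall A, measurable A -> P A = ereal_inf [set P V |
         V in [set V : set T | open V /\ A `<=` V]]),
      (forall A, measurable A -> P A = ereal_sup [set P K |
         K in [set K : set T | compact K /\ K `<=` A]])
    & forall f : T -> R, {within X, continuous f} ->
       ((L f)%:E <= \int[P]_(x in X) (f x)%:E)%E].
Proof.
have m_ge0 A : 0 <= m A.
  by apply: L_ge0 => [|x _]; [exact: bounded_on_indic|rewrite indicE].
have mU A B : A `&` B = set0 -> m (A `|` B) = m A + m B.
  move=> AB0; rewrite /m -LD; [|exact: bounded_on_indic..].
  congr L; apply/funext => x; rewrite -[RHS]/(\1_A x + \1_B x) !indicE in_setU.
  have [/set_mem Ax|nAx] := boolP (x \in A); last by rewrite add0r.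
  have [/set_mem Bx|nBx] := boolP (x \in B); last by rewrite addr0.
  by have : (A `&` B) x by []; rewrite AB0.
have mX : m X = 1.
  apply/eqP; rewrite -L1 eq_le !L_le ?L1//;
    do ?[exact: bounded_on_indic|exact: bounded_on_cst];
    by move=> x Xx; rewrite indicE mem_set.
have mXC : m (~` X) = 0.
  apply/eqP; rewrite eq_le m_ge0 andbT; have <- := L_cst 0; apply: L_le.
  - exact: bounded_on_indic.
  - exact: bounded_on_cst.
  - by move=> x Xx; rewrite indicE in_setC mem_set.
have [P [PX mP oP iP]] := riesz_measure hT cX m_ge0 mU mX mXC.
exists P; split => // f cf.
have mXb := compact_borel hT cX.
have iP1 g : {within X, continuous g} -> P.-integrable X (EFin \o g).
  exact: continuous_compact_integrable_prob.
(* The nonnegative functions for which the inequality is already known. *)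
pose Q (g : T -> R) := [/\ bounded_on X g,
  measurable_fun (X : set (g_sigma_algebraType (@open T))) g,
  (forall x, 0 <= g x) & ((L g)%:E <= \int[P]_(x in X) (g x)%:E)%E].
have Q0 : Q (cst 0).
  split=> //; first exact: bounded_on_cst.
  by rewrite L_cst integral0_eq.
have QD g h : Q g -> Q h -> Q (g + h).
  move=> [bg mg g0 Lg] [bh mh h0 Lh]; split.
  - exact: bounded_onD.
  - exact: measurable_funD.
  - by move=> x; rewrite addr_ge0.
  - rewrite LD// EFinD.
    apply: le_trans (leeD Lg Lh) _.
    rewrite -ge0_integralD//=; first by move=> x _; rewrite lee_fin.
      by apply/measurable_EFinP.
    by move=> x _; rewrite lee_fin.
  by apply/measurable_EFinP.
have Qind C : compact C -> C `<=` X -> Q \1_C.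
  move=> cC CX; have mC := compact_borel hT cC; split.
  - exact: bounded_on_indic.
  - exact: measurable_indic.
  - by move=> x; rewrite indicE.
  - by rewrite integral_indic// setIidl// mP.
have main (g : T -> R) : {within X, continuous g} -> (forall x, X x -> 0 <= g x) ->
    ((L g)%:E <= \int[P]_(x in X) (g x)%:E + 1)%E.
  move=> cg g0; have [K gK] := continuous_compact_bounded cX cg.
  pose n := (Num.truncn K).+1.
  pose C k := X `&` [set x | (k.+1%:R%:E <= (EFin \o g) x)%E].
  have cC k : compact (C k).
    by apply: compact_superlevel => //; exact: continuous_usc_on.
  pose s : T -> R := \sum_(k < n) \1_(C k).
  have [bs ms s0 Ls] : Q s.
    by rewrite /s; elim/big_ind : _ => // k _; apply: Qind => // x [].
  have sg x : X x -> s x <= g x /\ g x <= s x + 1.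
    move=> Xx; have [h1 h2] := layer_cake_bounds n (g0 _ Xx).
    have -> : s x = \sum_(k < n) (k.+1%:R <= g x)%R%:R.
      rewrite /s fct_sumE; apply: eq_bigr => k _; rewrite indicE; congr (nat_of_bool _)%:R.
      by apply/idP/idP => [/set_mem[]|h]; rewrite ?inE /C/= lee_fin.
    split => //; apply: h2; apply: le_trans (ltW (truncnS_gt K)).
    by apply: le_trans (gK _ Xx); exact: ler_norm.
  have bg : bounded_on X g by exists K.
  have /L_le : forall x, X x -> g x <= (s + cst 1) x by move=> x /sg[].
  have b1 := bounded_on_cst X (1 : R).
  move=> /(_ bg (bounded_onD bs b1)); rewrite LD// L1 -lee_fin EFinD => h.
  apply: (le_trans h); apply: leeD => //; apply: (le_trans Ls).
  by apply: le_integral_pointwise => x /sg[? _]; rewrite lee_fin.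
have [K fK] := continuous_compact_bounded cX cf.
have K1 : 0 < `|K| + 1 by rewrite ltr_wpDl.
apply/lee_addgt0Pr => e e0.
(* Shifting f makes it nonnegative, dividing it by e turns the error 1 into e. *)
pose g : T -> R := e^-1 *: (f + cst (`|K| + 1)).
have bf : bounded_on X f by exists K.
have bK := bounded_on_cst X (`|K| + 1).
have gE x : g x = e^-1 * (f x + (`|K| + 1)) by [].
have cg : {within X, continuous g}.
  move=> x; apply: cvgMl_tmp.
  by apply: cvgD; [exact: cf|exact: cvg_cst].
have g0 x : X x -> 0 <= g x.
  move=> Xx; rewrite gE mulr_ge0 ?invr_ge0 ?(ltW e0)//.
  have := fK _ Xx; rewrite ler_norml => /andP[+ _]; have := ler_norm K; lra.
have := main g cg g0; rewrite {1}/g LZ; last exact: bounded_onD.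
rewrite LD// L_cst.
under eq_integral do rewrite gE EFinM EFinD.
have if1 : P.-integrable X (fun x => (f x)%:E) by exact: iP1.
have iK : P.-integrable X (fun x => (`|K| + 1)%:E).
  by apply: (iP1 (cst (`|K| + 1))) => x; exact: cvg_cst.
rewrite integralZl//; last exact: integrableD.
rewrite integralD// integral_prob_cst//.
have fin : (\int[P]_(x in X) (f x)%:E \is a fin_num)%E by exact: integrable_fin_num.
rewrite -(fineK fin); set I := fine _.
rewrite [X in (_ <= X)%E -> _](_ : _ = (e^-1 * (I + (`|K| + 1)) + 1)%:E)//.
rewrite -EFinD !lee_fin.
move=> /(ler_wpM2l (ltW e0)).
rewrite mulrA mulfV ?gt_eqF// mul1r mulrDr mulrA mulfV ?gt_eqF// mul1r mulr1.
lra.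
Qed.

End riesz_domination.

(** * Means over circles *)

Section circle_mean.
Variable R : realType.
Implicit Types (g h : R -> R).
Local Notation mu := (@lebesgue_measure R).

Definition circle_mean g : R :=
  (2 * pi)^-1 * \int[mu]_(t in `[0, 2 * pi]) g t.

Let pi2 : 0 < 2 * pi :> R. Proof. by rewrite mulr_gt0// pi_gt0. Qed.

Lemma continuous_integrable_itv g a b : continuous g ->
  mu.-integrable `[a, b] (EFin \o g).
Proof.
move=> cg; apply: continuous_compact_integrable; first exact: segment_compact.
exact: continuous_subspaceT.
Qed.

Lemma circle_meanE g : continuous g ->
  ((circle_mean g)%:E = ((2 * pi)^-1)%:E * \int[mu]_(t in `[0%R, (2 * pi)%R]) (g t)%:E)%E.
Proof.
move=> cg; rewrite /circle_mean EFinM; congr (_ * _)%E.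
rewrite /Rintegral fineK//; apply: integrable_fin_num => //.
exact: continuous_integrable_itv.
Qed.

Lemma circle_mean_cst (c : R) : circle_mean (cst c) = c.
Proof.
rewrite /circle_mean Rintegral_cst//=.
rewrite lebesgue_measure_itv/= lte_fin pi2 -EFinB/= subr0.
by rewrite mulrC -mulrA mulfV ?mulr1// gt_eqF.
Qed.

Lemma circle_meanD g h : continuous g -> continuous h ->
  circle_mean (fun t => g t + h t) = circle_mean g + circle_mean h.
Proof.
move=> cg ch; rewrite /circle_mean RintegralD ?mulrDr//.
all: exact: continuous_integrable_itv.
Qed.

Lemma circle_meanZ (c : R) g : continuous g ->
  circle_mean (fun t => c * g t) = c * circle_mean g.
Proof.
move=> cg; rewrite /circle_mean RintegralZl// 1?mulrCA//.
exact: continuous_integrable_itv.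
Qed.

Lemma le_circle_mean g h : continuous g -> continuous h ->
  (forall t, g t <= h t) -> circle_mean g <= circle_mean h.
Proof.
move=> cg ch gh; rewrite ler_wpM2l ?invr_ge0 ?(ltW pi2)//.
by apply: le_Rintegral => //; exact: continuous_integrable_itv.
Qed.

Lemma circle_mean_sum n (g : 'I_n -> R -> R) : (forall i, continuous (g i)) ->
  circle_mean (fun t => \sum_i g i t) = \sum_i circle_mean (g i).
Proof.
elim: n g => [|n IH] g cg.
  rewrite big_ord0 -{2}(circle_mean_cst 0); congr circle_mean.
  by apply/funext => t; rewrite big_ord0.
rewrite big_ord_recr/= -IH//.
have cs : continuous (fun t => \sum_(i < n) g (widen_ord (leqnSn n) i) t).
  exact: continuous_sum.
rewrite -circle_meanD//; congr circle_mean.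
by apply/funext => t; rewrite big_ord_recr.
Qed.

(** A continuous function with a mean at least its upper bound is constant. The
    angle pi is chosen because it is interior to [0, 2 pi] and gives the point
    -1 of the circle. *)
Lemma circle_mean_max_pi g (M : R) : continuous g -> (forall t, g t <= M) ->
  M <= circle_mean g -> g pi = M.
Proof.
move=> cg gM Mg; apply/eqP; rewrite eq_le gM/= leNgt; apply/negP => gpi.
pose h t := M - g t.
have ch : continuous h by move=> t; apply: cvgB; [exact: cvg_cst|exact: cg].
have h0 t : 0 <= h t by rewrite subr_ge0.
have int0 : \int[mu]_(t in `[0, 2 * pi]) h t <= 0.
  have cM : continuous (cst M : R -> R) by move=> t; exact: cvg_cst.
  rewrite (RintegralB _ (continuous_integrable_itv _ _ cM) (continuous_integrable_itv _ _ cg))//.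
  rewrite -(ler_pM2l (x := (2 * pi)^-1)) ?invr_gt0// mulr0 mulrBr.
  by rewrite -/(circle_mean (cst M)) circle_mean_cst subr_le0.
pose c := h pi / 2.
have hpi : 0 < h pi by rewrite subr_gt0.
have c0 : 0 < c by rewrite divr_gt0.
have ch_pi : c < h pi by rewrite /c; lra.
have nc : \forall t \near (pi : R), c < h t := ch pi _ (lt_nbhsr ch_pi).
have [d /= d0 hd] : exists2 d : R, 0 < d & forall t, `|pi - t| < d -> c < h t.
  by move: nc => /nbhs_ballP[d d0 hd]; exists d => // t; exact: hd.
pose e := Order.min d pi / 2.
have e0 : 0 < e by rewrite divr_gt0// lt_min d0 pi_gt0.
have ed : e < d.
  by rewrite /e ltr_pdivrMr//; have := ge_min d d pi; rewrite lexx/=; lra.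
have epi : e < pi.
  rewrite /e ltr_pdivrMr//; have := ge_min pi d pi; rewrite lexx orbT.
  by have := @pi_gt0 R; lra.
have : (\int[mu]_(t in `[(pi - e)%R, (pi + e)%R]) c%:E <= \int[mu]_(t in `[0%R, (2 * pi)%R]) (h t)%:E)%E.
  have mh D : measurable_fun D (EFin \o h : R -> \bar R).
    by apply/measurable_EFinP; apply: measurable_funTS; exact: continuous_measurable_fun.
  apply: (@le_trans _ _ (\int[mu]_(t in `[(pi - e)%R, (pi + e)%R]) (h t)%:E)%E).
    apply: ge0_le_integral => //=; do ?[by move=> t _; rewrite lee_fin ltW|exact: mh].
    move=> t; rewrite in_itv/= => /andP[t1 t2]; rewrite lee_fin ltW// hd//.
    by rewrite ltr_norml; apply/andP; split; lra.
  apply: ge0_subset_integral => //=; do ?[exact: mh].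
    by move=> t _; rewrite lee_fin.
  by move=> t/=; rewrite !in_itv/= => /andP[t1 t2]; apply/andP; split; lra.
rewrite integral_cst//= lebesgue_measure_itv/= lte_fin ltrD2l gtrN//.
rewrite -EFinB -EFinM => H.
have fin : (\int[mu]_(t in `[0%R, (2 * pi)%R]) (h t)%:E)%E \is a fin_num.
  by apply: integrable_fin_num => //; exact: continuous_integrable_itv.
move: H int0; rewrite /Rintegral -{1}(fineK fin) lee_fin => H1 H2.
have : c * (pi + e - (pi - e)) <= 0 by exact: le_trans H2.
rewrite leNgt => /negP; apply; apply: mulr_gt0 => //; lra.
Qed.

End circle_mean.

(** * Real-valued norms on complex normed spaces *)

(** The norm of a complex normed space is C-valued; this is the corresponding
    real number, for which the order is total. *)
Definition nrm (R : realType) (V : normedModType (Cplx R)) (x : V) : R :=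
  complex.Re (`|x| : R[i]).

Section nrm.
Variables (R : realType) (V : normedModType (Cplx R)).
Implicit Types x y : V.

Lemma nrmE x : `|x| = (nrm x)%:C :> Cplx R.
Proof. by rewrite /nrm [RHS]RRe_real// ger0_real. Qed.

Lemma nrm_ge0 x : 0 <= nrm x.
Proof. by rewrite -ler0c -nrmE. Qed.

Lemma nrm0 : nrm (0 : V) = 0.
Proof. by rewrite /nrm normr0. Qed.

Lemma nrm_eq0 x : nrm x = 0 -> x = 0.
Proof. by move=> x0; apply/eqP; rewrite -normr_eq0 nrmE x0. Qed.

Lemma nrmN x : nrm (- x) = nrm x.
Proof. by rewrite /nrm normrN. Qed.

Lemma nrmBC x y : nrm (x - y) = nrm (y - x).
Proof. by rewrite -opprB nrmN. Qed.

Lemma ler_nrmD x y : nrm (x + y) <= nrm x + nrm y.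
Proof. by rewrite -lecR rmorphD/= -!nrmE; exact: ler_normD. Qed.

Lemma ler_dist_nrmD x y z : nrm (x - z) <= nrm (x - y) + nrm (y - z).
Proof. by have := ler_nrmD (x - y) (y - z); rewrite addrA subrK. Qed.

Lemma nbhs_nrmP x (A : set V) :
  nbhs x A <-> exists2 r : R, 0 < r & forall y, nrm (x - y) < r -> A y.
Proof.
split=> [/nbhs_ballP[e e0 eA]|[r r0 rA]].
  have eE : e = (complex.Re (e : R[i]))%:C.
    by rewrite [RHS]RRe_real// gtr0_real.
  exists (complex.Re (e : R[i])); first by rewrite -ltcR -eE.
  by move=> y xy; apply: eA; rewrite -ball_normE/= nrmE eE ltcR.
apply/nbhs_ballP; exists (r%:C : Cplx R) => /=; first by rewrite ltcR.
by move=> y; rewrite -ball_normE/= nrmE ltcR; exact: rA.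
Qed.

Lemma near_nrm x (r : R) : 0 < r -> \forall y \near x, nrm (x - y) < r.
Proof. by move=> r0; apply/nbhs_nrmP; exists r. Qed.

Lemma open_nrm_ball x (r : R) : open [set y | nrm (x - y) < r].
Proof.
rewrite openE => y /= xy; apply/nbhs_nrmP; exists (r - nrm (x - y)).
  by rewrite subr_gt0.
by move=> z yz /=; have := ler_dist_nrmD x y z; lra.
Qed.

(** The one-sided bound is symmetric in x and y, hence it is a Lipschitz bound. *)
Lemma lipschitz_continuous (k : R) (f : V -> R) :
  (forall x y, f y <= f x + k * nrm (x - y)) -> continuous f.
Proof.
move=> fk x; apply/cvgrPdist_lt => e e0.
have k1 : 0 < `|k| + 1 by rewrite ltr_wpDl.
have : 0 < e / (`|k| + 1) by rewrite divr_gt0.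
move=> /(near_nrm x); apply: filterS => y.
rewrite ltr_pdivlMr// => xy; apply: le_lt_trans xy.
have h0 := nrm_ge0 (x - y); have hk : k * nrm (x - y) <= nrm (x - y) * (`|k| + 1).
  rewrite mulrC ler_wpM2l//; have := ler_norm k; lra.
rewrite ler_norml; have := fk x y; have := fk y x; rewrite (nrmBC y x) => *.
by apply/andP; split; lra.
Qed.

Lemma nrm_continuous : continuous (@nrm R V).
Proof.
apply: (@lipschitz_continuous 1) => x y; rewrite mul1r nrmBC.
by have := ler_nrmD x (y - x); rewrite addrC subrK.
Qed.

Lemma closed_nrm_ball (r : R) : closed [set x : V | nrm x <= r].
Proof.
rewrite (_ : mkset _ = @nrm R V @^-1` [set x | x <= r])//.
by apply: (closed_comp (fun x _ => @nrm_continuous x)); exact: closed_le.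
Qed.

Lemma cvg_nrm (T : Type) (F : set_system T) (f : T -> V) y : Filter F ->
  (forall e : R, 0 < e -> \forall t \near F, nrm (y - f t) < e) -> f @ F --> y.
Proof. by move=> FF h A /nbhs_nrmP[r r0 rA]; apply: filterS (h r r0) => t /rA. Qed.

Lemma hausdorff_nrm : hausdorff_space V.
Proof. exact: norm_hausdorff. Qed.

End nrm.

Lemma nrmZ (R : realType) (V : normedModType (Cplx R)) (a : Cplx R) (x : V) :
  nrm (a *: x) = nrm a * nrm x.
Proof. by apply: complexI; rewrite rmorphM/= -!nrmE normrZ. Qed.

Lemma nrmM (R : realType) (a b : Cplx R) : nrm (a * b) = nrm a * nrm b.
Proof. by apply: complexI; rewrite rmorphM/= -!nrmE normrM. Qed.

Lemma nrm1 (R : realType) : nrm (1 : Cplx R) = 1.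
Proof. by rewrite /nrm normr1. Qed.

Lemma nrm_realC (R : realType) (x : R) : nrm (x%:C : Cplx R) = `|x|.
Proof.
by rewrite /nrm normc_def/= expr0n/= addr0 sqrtr_sqr.
Qed.

Lemma realC_continuous (R : realType) : continuous (fun x : R => x%:C : Cplx R).
Proof.
move=> x; apply: cvg_nrm => e e0.
have : \forall y \near x, `|x - y| < e by exact: (@nbhsx_ballx _ _ x e e0).
by apply: filterS => y; rewrite -rmorphB/= nrm_realC.
Qed.

Definition disc (R : realType) (r : R) : set (Cplx R) := [set w | nrm w <= r].

Lemma compact_disc (R : realType) (r : R) : compact (disc r).
Proof.
pose f (p : R * R) : Cplx R := (p.1)%:C + 'i%C * (p.2)%:C.
have cf : continuous f.
  move=> p; apply: cvgD.
    by apply: continuous_comp; [exact: cvg_fst|exact: realC_continuous].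
  apply: cvgM; first exact: cvg_cst.
  by apply: continuous_comp; [exact: cvg_snd|exact: realC_continuous].
have cS : compact (f @` (`[-r, r] `*` `[-r, r])).
  apply: continuous_compact; first exact: continuous_subspaceT.
  by apply: compact_setX; exact: segment_compact.
apply: subclosed_compact cS _.
  exact: closed_nrm_ball.
move=> w wr; exists (complex.Re (w : R[i]), complex.Im (w : R[i])).
  have h := wr; rewrite /disc/= /nrm normc_def/= in h.
  split=> /=; rewrite in_itv/= -ler_norml; apply: le_trans h.
    by rewrite -sqrtr_sqr ler_sqrt ?lerDl ?sqr_ge0// addr_ge0 ?sqr_ge0.
  by rewrite -sqrtr_sqr ler_sqrt ?lerDr ?sqr_ge0// addr_ge0 ?sqr_ge0.
by rewrite /f/= -complexE.
Qed.

(** * The mean inequality on a disc is local *)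

(** With G a primitive of g, the integral of g over a period starting at s is
    G (2 pi + s) - G s, and the derivative of this in s vanishes. *)
Lemma circle_mean_shift (R : realType) (g : R -> R) s : continuous g ->
  (forall t, g (t + 2 * pi) = g t) -> 0 <= s ->
  circle_mean (fun t => g (t + s)) = circle_mean g.
Proof.
move=> cg gper s0; set mu := @lebesgue_measure R.
have pi2 : 0 < 2 * pi :> R by rewrite mulr_gt0// pi_gt0.
(* The primitive starts at -1 so that it is differentiable at 0. *)
pose G (x : R) : R := \int[mu]_(t in `[-1, x]) g t.
have dG (x : R) : -1 < x -> is_derive x 1 G (g x).
  move=> x1; have xx1 : x < x + 1 by rewrite ltrDl.
  have [dGx G'x] := @continuous_FTC1_closed R g (-1) x (x + 1) xx1
    (continuous_integrable_itv _ _ cg) x1 (cg x).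
  by apply: DeriveDef => //; rewrite -derive1E.
have dF (r t : R) : -1 < t + r -> is_derive t 1 (fun t => G (t + r)) (g (t + r)).
  move=> /dG dGt.
  have dt : is_derive t 1 (fun t : R => t + r) 1.
    by rewrite -[X in is_derive _ _ _ X]addr0; apply: is_deriveD.
  by rewrite -[X in is_derive _ _ _ X]mulr1; exact: (@is_derive1_comp R G).
have GE (r : R) : 0 <= r -> \int[mu]_(t in `[0, 2 * pi]) g (t + r) = G (2 * pi + r) - G r.
  move=> r0.
  have cF (t : R) : 0 <= t -> {for t, continuous (fun t => G (t + r))}.
    move=> t0; apply: differentiable_continuous; apply/derivable1_diffP.
    by have [] := dF r t ltac:(lra).
  rewrite /Rintegral (@continuous_FTC2 _ _ (fun t => G (t + r)) 0 (2 * pi)) ?add0r//.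
  - apply: continuous_subspaceT => t; apply: continuous_comp; last exact: cg.
    by apply: cvgD; [exact: cvg_id|exact: cvg_cst].
  - split.
    + move=> t; rewrite in_itv/= => /andP[t0 _].
      by have [] := dF r t ltac:(lra).
    + by apply: cvg_at_right_filter; exact: cF.
    + by apply: cvg_at_left_filter; apply: cF; exact: ltW.
  - move=> t; rewrite in_itv/= => /andP[t0 _]; rewrite derive1E.
    by have [] := dF r t ltac:(lra).
rewrite /circle_mean GE//; congr (_ * _).
have -> : \int[mu]_(t in `[0, 2 * pi]) g t = G (2 * pi) - G 0.
  have := GE 0 (lexx _); rewrite addr0 => <-.
  by apply: eq_Rintegral => t _; rewrite addr0.
move: s0; rewrite le_eqVlt => /predU1P[<-|s0]; first by rewrite addr0.
pose D (r : R) : R := G (2 * pi + r) - G r.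
have dD (r : R) : -1 < r -> is_derive r 1 D 0.
  move=> r1; have -> : 0 = g (r + 2 * pi) - g r by rewrite gper subrr.
  rewrite (_ : D = (fun t => G (t + 2 * pi)) - G); last first.
    by apply/funext => t; rewrite -[RHS]/(G (t + 2 * pi) - G t) /D (addrC t).
  have r2 : -1 < r + 2 * pi by lra.
  exact: (@is_deriveB R R R (fun t => G (t + 2 * pi)) G r 1 _ _ (dF _ _ r2) (dG _ r1)).
have [||c _] := @MVT_segment R D (fun=> 0) 0 s (ltW s0).
  by move=> r; rewrite in_itv/= => /andP[r0 _]; apply: dD; lra.
  apply: continuous_in_subspaceT => r; rewrite inE/= in_itv/= => /andP[r0 _].
  apply: differentiable_continuous; apply/derivable1_diffP.
  by have [] := dD r ltac:(lra).
by rewrite mul0r /D addr0; lra.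
Qed.

Definition cis (R : realType) (t : R) : Cplx R := cos t +i* sin t.

Section cis.
Variable R : realType.
Implicit Types s t : R.

Lemma cisE t : cis t = (cos t)%:C + 'i%C * (sin t)%:C :> Cplx R.
Proof. by rewrite [LHS]complexE. Qed.

Lemma cisD s t : cis (s + t) = cis s * cis t.
Proof. by rewrite /cis cosD sinD; apply/eqP; rewrite eq_complex/= eqxx/= addrC. Qed.

Lemma cispi : cis (pi : R) = -1.
Proof. by rewrite /cis cospi sinpi; apply/eqP; rewrite eq_complex/= oppr0 !eqxx. Qed.

Lemma cis2pi t : cis (t + 2 * pi) = cis t.
Proof. by rewrite mulrC mulr_natr /cis cosD2pi sinD2pi. Qed.

Lemma nrm_cis t : nrm (cis t) = 1.
Proof. by rewrite /nrm normc_def/= cos2Dsin2 sqrtr1. Qed.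

Lemma continuous_cis : continuous (@cis R).
Proof.
move=> t; rewrite (_ : @cis R = (fun t => (cos t)%:C + 'i%C * (sin t)%:C)); last first.
  by apply/funext => x; rewrite cisE.
apply: cvgD.
  by apply: continuous_comp; [exact: continuous_cos|exact: realC_continuous].
apply: cvgM; first exact: cvg_cst.
by apply: continuous_comp; [exact: continuous_sin|exact: realC_continuous].
Qed.

Lemma cis_arg (w : Cplx R) : nrm w = 1 -> exists2 t, -pi <= t <= pi & w = cis t.
Proof.
move=> w1; have [a [b wE]] : exists a b, w = a +i* b by case: w {w1} => a b; exists a, b.
have {w1}ab : a ^+ 2 + b ^+ 2 = 1.
  move: w1; rewrite wE /nrm normc_def/= => ab1.
  by rewrite -[LHS]sqr_sqrtr ?addr_ge0 ?sqr_ge0// ab1 expr1n.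
have a1 : -1 <= a <= 1.
  by rewrite -ler_norml -sqrtr_sqr -sqrtr1 ler_sqrt//; have := sqr_ge0 b; lra.
have pi0 := @pi_ge0 R.
have sa : sin (acos a) = `|b|.
  by rewrite sin_acos// -sqrtr_sqr; congr Num.sqrt; lra.
have ca : cos (acos a) = a by rewrite acosK// inE.
have h0 := acos_ge0 a1; have hpi := acos_lepi a1.
have [b0|b0] := leP 0 b.
  exists (acos a); first by apply/andP; split; lra.
  by rewrite /cis ca sa ger0_norm.
exists (- acos a); first by apply/andP; split; lra.
by rewrite /cis cosN sinN ca sa ltr0_norm// opprK.
Qed.

End cis.

Section disc_mean.
Variables (R : realType) (f : Cplx R -> R).
Hypotheses (cf : forall w, nrm w <= 1 -> {for w, continuous f})
  (f_sub : forall p, nrm p < 1 -> exists2 r : R, 0 < r &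
    forall b, nrm b < r -> f p <= circle_mean (fun t => f (p + cis t * b))).

Let g t := f (cis t).

Let cg : continuous g.
Proof.
move=> t; apply: (@continuous_comp _ _ _ (@cis R) f); first exact: continuous_cis.
by apply: cf; rewrite nrm_cis.
Qed.

(** The rotations by the N.+1-th roots of unity, of angles the multiples of tau,
    turn f into an average F which still satisfies the local mean inequality and
    has period tau on the unit circle. *)
Section rotations.
Variable N : nat.
Let tau : R := (2 * pi) / N.+1%:R.
Let F w := N.+1%:R^-1 * \sum_(j < N.+1) f (cis (tau *+ j) * w).

Let cF w : nrm w <= 1 -> {for w, continuous F}.
Proof.
move=> w1; suff cS : {for w, continuous (\sum_(j < N.+1) (fun w => f (cis (tau *+ j) * w)))}.
  have -> : F = N.+1%:R^-1 *: (\sum_(j < N.+1) (fun w => f (cis (tau *+ j) * w))).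
    by apply/funext => z; rewrite -[RHS]/(_ * _) fct_sumE.
  exact: (cvgZl_tmp cS).
elim/big_ind : _ => [|h k ch ck|i _].
- exact: (@cst_continuous (Cplx R) R 0 w).
- exact: cvgD ch ck.
-
apply: (@continuous_comp _ _ _ (fun w => cis (tau *+ i) * w) f).
  exact: mulrl_continuous.
by apply: cf; rewrite nrmM nrm_cis mul1r.
Qed.

Let F_sub p : nrm p < 1 -> exists2 r : R, 0 < r &
  forall b, nrm b < r -> F p <= circle_mean (fun t => F (p + cis t * b)).
Proof.
move=> p1.
have sub_j : \forall r \near (0 : R)^'+, forall (j : 'I_N.+1) b, nrm b < r ->
    f (cis (tau *+ j) * p) <= circle_mean (fun t => f (cis (tau *+ j) * (p + cis t * b))).
  apply: filter_forall => j.
  have pj1 : nrm (cis (tau *+ j) * p) < 1 by rewrite nrmM nrm_cis mul1r.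
  have [r r0 hr] := f_sub pj1.
  apply: filterS (nbhs_right_lt r0) => d dr b bd.
  have := hr (cis (tau *+ j) * b); rewrite nrmM nrm_cis mul1r => /(_ (lt_trans bd dr)).
  congr (_ <= circle_mean _); apply/funext => t; congr f.
  by rewrite mulrDr mulrCA.
near (0 : R)^'+ => r; exists r; first by near: r; exact: nbhs_right_gt.
have sub : forall (j : 'I_N.+1) b, nrm b < r ->
    f (cis (tau *+ j) * p) <= circle_mean (fun t => f (cis (tau *+ j) * (p + cis t * b))).
  by near: r; exact: sub_j.
move=> b br.
have pb : nrm p + nrm b <= 1.
  have : r < 1 - nrm p by near: r; apply: nbhs_right_lt; rewrite subr_gt0.
  lra.
have cj j : continuous (fun t => f (cis (tau *+ j) * (p + cis t * b))).
  move=> t; apply: (@continuous_comp _ _ _ (fun t => cis (tau *+ j) * (p + cis t * b)) f).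
    apply: cvgM; first exact: cvg_cst.
    by apply: cvgD; [exact: cvg_cst|apply: cvgM; [exact: continuous_cis|exact: cvg_cst]].
  apply: cf; rewrite nrmM nrm_cis mul1r; apply: le_trans pb.
  by apply: le_trans (ler_nrmD _ _) _; rewrite nrmM nrm_cis mul1r.
rewrite circle_meanZ; last by apply: continuous_sum => j; exact: cj.
rewrite circle_mean_sum; last by move=> j; exact: cj.
by rewrite ler_wpM2l ?invr_ge0//; apply: ler_sum => j _; exact: sub.
Unshelve. all: by end_near. Qed.

(** Maximum principle: among the points of the closed disc where F is maximal,
    let p have largest modulus. If p were inside, the mean inequality on a small
    circle around p would make F maximal on all of that circle, which contains
    points of larger modulus. *)
Let F_max : exists2 t, -pi <= t <= pi & F 0 <= F (cis t).
Proof.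
have cFD : {within disc 1, continuous F}.
  by apply/subspace_continuousP => w w1; apply: cvg_within_filter; exact: cF.
have D0 : @disc R 1 !=set0 by exists 0; rewrite /disc/= nrm0.
have [c c1 Fc] := compact_max (@compact_disc R 1) D0 cFD.
pose E := disc 1 `&` [set w | ((F c)%:E <= (EFin \o F) w)%E].
have cE : compact E.
  by apply: compact_superlevel; [exact: compact_disc|exact: continuous_usc_on].
have E0 : E !=set0 by exists c; split => //=.
have cnE : {within E, continuous (@nrm R (Cplx R))}.
  by apply: continuous_subspaceT; exact: nrm_continuous.
have [p [/= p1 Fp] pmax] := compact_max cE E0 cnE.
rewrite lee_fin in Fp.
have [p_eq1|p_lt1] := eqVneq (nrm p) 1.
  have [t t1 pE] := cis_arg p_eq1; exists t => //.
  by rewrite -pE; apply: le_trans Fp; apply: Fc; rewrite /disc/= nrm0.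
have {p_lt1}p_lt1 : nrm p < 1 by rewrite lt_neqAle p_lt1.
(* The direction that leads away from 0; any direction will do at 0. *)
have [v v0 pv] : exists2 v : Cplx R, 0 < nrm v &
    forall d : R, 0 < d -> nrm p < nrm (p + d%:C * v).
  have [p0|p0] := eqVneq p 0.
    exists 1; first by rewrite nrm1.
    by move=> d d0; rewrite p0 add0r mulr1 nrm0 nrm_realC gtr0_norm.
  have np0 : 0 < nrm p.
    by rewrite lt_neqAle nrm_ge0 andbT; apply: contra_neq p0 => /esym/nrm_eq0.
  exists p => // d d0; rewrite -{2}[p]mul1r -mulrDl -(rmorph1 (real_complex R)).
  rewrite -rmorphD/= nrmM nrm_realC ltr_pMl//.
  by rewrite gtr0_norm ?addr_gt0// ltrDl.
have [r r0 hr] := F_sub p_lt1.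
pose d := Order.min r (1 - nrm p) / (2 * nrm v).
have d0 : 0 < d by rewrite divr_gt0 ?mulr_gt0// lt_min r0 subr_gt0.
have dv : d * nrm v = Order.min r (1 - nrm p) / 2.
  by rewrite /d invfM mulrA mulfVK ?gt_eqF.
have [dr d1] : d * nrm v < r /\ d * nrm v <= 1 - nrm p.
  have := ge_min r r (1 - nrm p); have := ge_min (1 - nrm p) r (1 - nrm p).
  by rewrite !lexx orbT dv => h1 h2; split; lra.
pose b : Cplx R := - (d%:C * v).
have nb : nrm b = d * nrm v by rewrite nrmN nrmM nrm_realC gtr0_norm.
have pb : nrm p + nrm b <= 1 by rewrite nb; lra.
have in_disc t : nrm (p + cis t * b) <= 1.
  by apply: le_trans pb; apply: le_trans (ler_nrmD _ _) _; rewrite nrmM nrm_cis mul1r.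
have cFb : continuous (fun t => F (p + cis t * b)).
  move=> t; apply: (@continuous_comp _ _ _ (fun t => p + cis t * b) F).
    by apply: cvgD; [exact: cvg_cst|apply: cvgM; [exact: continuous_cis|exact: cvg_cst]].
  exact: cF.
have Fpi : F (p + cis pi * b) = F c.
  apply: (circle_mean_max_pi cFb) => [t|]; first exact/Fc/in_disc.
  by apply: (le_trans Fp); apply: hr; rewrite nb.
have : nrm (p + cis pi * b) <= nrm p.
  by apply: pmax; split; [exact: in_disc|rewrite /= Fpi].
by rewrite cispi mulN1r opprK leNgt pv.
Qed.

Let FE t : F (cis t) = N.+1%:R^-1 * \sum_(j < N.+1) g (t + tau *+ j).
Proof. by congr (_ * _); apply: eq_bigr => j _; rewrite -cisD addrC. Qed.

Let gper t : g (t + 2 * pi) = g t.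
Proof. by rewrite /g cis2pi. Qed.

Let F_periodic t : F (cis (t + tau)) = F (cis t).
Proof.
rewrite !FE; congr (_ * _).
under eq_bigr do rewrite -addrA -mulrS.
rewrite big_ord_recr/= [RHS]big_ord_recl/= addrC; congr (_ + _).
by rewrite -mulr_natr /tau divfK ?pnatr_eq0// gper mulr0n addr0.
Qed.

Let F_periodicz t (k : int) : F (cis (t + k%:~R * tau)) = F (cis t).
Proof.
have Fn u (n : nat) : F (cis (u + n%:R * tau)) = F (cis u).
  elim: n => [|n IH]; first by rewrite mul0r addr0.
  by rewrite -natr1 mulrDl mul1r addrA F_periodic.
case: k => n; first exact: Fn.
rewrite NegzE mulrNz mulNr -[in LHS](Fn _ n.+1).
by rewrite -pmulrn subrK.
Qed.

Let mean_F : circle_mean (fun t => F (cis t)) = circle_mean g.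
Proof.
rewrite circle_meanZ; last first.
  apply: continuous_sum => j t.
  apply: (@continuous_comp _ _ _ (fun t => cis (tau *+ j) * cis t) f).
    by apply: cvgM; [exact: cvg_cst|exact: continuous_cis].
  by apply: cf; rewrite nrmM !nrm_cis mul1r.
rewrite (_ : (fun t => _) = (fun t => \sum_(j < N.+1) g (t + tau *+ j))); last first.
  by apply/funext => t; apply: eq_bigr => j _; rewrite -cisD addrC.
rewrite circle_mean_sum; last first.
  move=> j t; apply: (@continuous_comp _ _ _ (fun t => t + tau *+ j) g); last exact: cg.
  by apply: cvgD; [exact: cvg_id|exact: cvg_cst].
under eq_bigr do rewrite circle_mean_shift// ?mulrn_wge0 ?divr_ge0// ?mulr_ge0 ?pi_ge0//.
by rewrite sumr_const card_ord -[X in _ * X]mulr_natl mulKf ?pnatr_eq0.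
Qed.

(** On the unit circle F has the same mean as f, and up to e it is constant,
    since its period tau is too short for larger oscillations. Its mean is
    therefore at least its maximum minus e, hence at least F 0 - e = f 0 - e. *)
Lemma rotation_mean_bound (e : R) :
  (forall s t, - pi <= s <= 3 * pi -> `|s - t| <= tau -> `|g s - g t| <= e) ->
  f 0 <= circle_mean g + e.
Proof.
move=> unif; have [s /andP[s1 s2] Fs] := F_max.
have F00 : F 0 = f 0.
  rewrite /F; under eq_bigr do rewrite mulr0.
  by rewrite sumr_const card_ord -[X in _ * X]mulr_natl mulKf ?pnatr_eq0.
have tau0 : 0 < tau by rewrite divr_gt0// mulr_gt0// pi_gt0.
have Ft t : f 0 - e <= F (cis t).
  (* Move t by a multiple of the period into [s, s + tau[. *)
  pose k := Num.floor ((t - s) / tau).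
  have k1 : k%:~R * tau <= t - s by rewrite -ler_pdivlMr//; exact: floor_le.
  have k2 : t - s < k%:~R * tau + tau.
    rewrite (_ : _ + tau = (k%:~R + 1) * tau); last by rewrite mulrDl mul1r.
    rewrite -ltr_pdivrMr//.
    by have := floorD1_gt ((t - s) / tau); rewrite intrD.
  rewrite -(F_periodicz t (- k)); set t' := t + _.
  have [t1 t2] : s <= t' /\ t' < s + tau.
    by rewrite /t' mulrNz mulNr; split; lra.
  rewrite lerBlDr -F00; apply: (le_trans Fs); rewrite !FE.
  rewrite -lerBlDl -mulrBr -sumrB ler_pdivrMl ?ltr0n//.
  apply: (@le_trans _ _ (\sum_(j < N.+1) e)); last first.
    by rewrite sumr_const card_ord mulr_natl.
  apply: ler_sum => j _; apply: (le_trans (ler_norm _)); apply: unif.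
    have jN : j%:R * tau <= 2 * pi.
      rewrite /tau mulrCA ler_piMr ?mulr_ge0 ?pi_ge0//.
      by rewrite ler_pdivrMr ?ltr0n// mul1r ler_nat ltnW.
    have : 0 <= j%:R * tau by rewrite mulr_ge0// ltW.
    by rewrite mulr_natl in jN *; move=> h; apply/andP; split; lra.
  by rewrite opprD addrACA subrr addr0 ler0_norm; lra.
rewrite -lerBlDr -mean_F -[X in X <= _]circle_mean_cst.
apply: le_circle_mean => // [t|t]; first exact: cvg_cst.
apply: (@continuous_comp _ _ _ (@cis R) F); first exact: continuous_cis.
by apply: cF; rewrite nrm_cis.
Qed.

End rotations.

(** Uniform continuity of f on the circle makes the oscillation of F smaller than
    any e once the number of rotations is large. *)
Lemma disc_mean : f 0 <= circle_mean g.
Proof.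
apply/ler_addgt0Pr => e e0.
have [d d0 hd] : exists2 d : R, 0 < d & forall s t, - pi <= s <= 3 * pi ->
    `|s - t| <= d -> `|g s - g t| <= e.
  have [||s s1|d d0 hd] := @compact_directed R `[- pi, 3 * pi] R [set d | 0 < d]
     (fun d s => forall t, `|s - t| <= d -> `|g s - g t| <= e) (@segment_compact _ _ _).
  - by exists 1 => /=.
  - move=> i j i0 j0; exists (Order.min i j); first by rewrite /= lt_min i0.
    by move=> x _ [] h t xt; apply: h; apply: (le_trans xt); rewrite ge_min lexx ?orbT.
  - have e2 : 0 < e / 2 by rewrite divr_gt0.
    have /cvgrPdist_lt/(_ _ e2)/nbhs_ballP[r r0 hr] := @cg s.
    exists (r / 2) => /=; first by rewrite divr_gt0.
    have r2 : 0 < r / 2 by rewrite divr_gt0.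
    apply/nbhs_ballP; exists (r / 2) => // x sx _ t xt.
    have h1 := hr x; have h2 := hr t; rewrite /ball/= in sx h1 h2.
    have {}h1 := h1 ltac:(lra).
    have {}h2 : `|g s - g t| < e / 2.
      by apply: h2; have := ler_distD x s t; lra.
    by have := ler_distD (g s) (g x) (g t); rewrite (distrC (g x) (g s)); lra.
  by exists d => // s t s1; apply: hd; rewrite /= in_itv.
pose N := Num.truncn (d^-1 * (2 * pi)).
apply: (@rotation_mean_bound N) => s t s1 st; apply: hd => //.
apply: (le_trans st); rewrite ler_pdivrMr ?ltr0n// -ler_pdivrMl//.
by apply: ltW; exact: truncnS_gt.
Qed.

End disc_mean.

(** * Continuous plurisubharmonic functions *)

Section cpsh.
Variables (R : realType) (n : nat).
Local Notation V := (Cspace R n).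
Implicit Types (U : set V) (v : V -> R) (a b x : V).

(** For continuous functions, [psh] is one inequality for each affine disc: the
    image of the closed unit disc under w |-> a + w b accounts for all centers
    and radii, and b may be multiplied by any complex number. *)
Definition cpsh U v : Prop :=
  (forall x, U x -> {for x, continuous v}) /\
  (forall a b, (forall w : Cplx R, nrm w <= 1 -> U (a + w *: b)) ->
    v a <= circle_mean (fun t => v (a + cis t *: b))).

Lemma slice_continuous a b : continuous (fun w : Cplx R => a + w *: b).
Proof.
have nb : 0 < nrm b + 1 by rewrite ltr_wpDl ?nrm_ge0.
move=> w A /nbhs_nrmP[r r0 rA]; apply/nbhs_nrmP; exists (r / (nrm b + 1)).
  by rewrite divr_gt0.
move=> y; rewrite ltr_pdivlMr// => wy; apply: rA.
rewrite opprD addrACA subrr add0r -scalerBl nrmZ.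
by apply: le_lt_trans wy; rewrite ler_wpM2l ?nrm_ge0// lerDl.
Qed.

Lemma circle_continuous U v a b : (forall x, U x -> {for x, continuous v}) ->
  (forall t, U (a + cis t *: b)) -> continuous (fun t : R => v (a + cis t *: b)).
Proof.
move=> cv ab t; apply: (@continuous_comp _ _ _ (fun t => a + cis t *: b) v).
  apply: (@continuous_comp _ _ _ (@cis R) (fun w => a + w *: b)).
    exact: continuous_cis.
  exact: slice_continuous.
exact: cv.
Qed.

Lemma psh_le_mean U (u : V -> \bar R) a b : psh U u ->
  (forall w : Cplx R, nrm w <= 1 -> U (a + w *: b)) ->
  (u a <= ((2 * pi)^-1)%:E *
    \int[lebesgue_measure]_(t in `[0%R, (2 * pi)%R]) u (a + cis t *: b)%R)%E.
Proof.
move=> [_ sub] abU; have [_ /(_ 0 1 ltr01)] := sub a b.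
have hD : [set w : Cplx R | `|w - 0| <= 1%:C] `<=` [set w | U (a + w *: b)].
  by move=> w; rewrite /= subr0 nrmE lecR => /abU.
move=> /(_ hD); rewrite scale0r addr0.
have -> : (fun t : R => u (a + (0 + ((1 * cos t) +i* (1 * sin t))%C) *: b)) =
    (fun t => u (a + cis t *: b)).
  by apply/funext => t; rewrite add0r !mul1r.
by [].
Qed.

Lemma cpshP U v : open U ->
  (psh U (EFin \o v) /\ {within U, continuous v}) <-> cpsh U v.
Proof.
move=> oU; split=> [[pU cv]|[cv sub]].
  have cvU x : U x -> {for x, continuous v}.
    by move: cv; rewrite continuous_open_subspace// => /(_ x) h Ux; apply: h; rewrite inE.
  split=> // a b abU; have := psh_le_mean pU abU.
  rewrite -[X in (_ * X)%E]/(\int[lebesgue_measure]_(t in `[0%R, (2 * pi)%R])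
    (v (a + cis t *: b))%:E)%E.
  rewrite -circle_meanE ?lee_fin//; apply: circle_continuous cvU _ => t.
  by apply: abU; rewrite nrm_cis.
split; last by rewrite continuous_open_subspace// => x; rewrite inE => /cv.
split; first exact: continuous_at_usc_on.
move=> a b; split.
  apply: (@continuous_at_usc_on _ _ _ (fun w : Cplx R => v (a + w *: b))) => w Uw.
  apply: (@continuous_comp _ _ _ (fun w : Cplx R => a + w *: b) v); last exact: cv.
  exact: slice_continuous.
move=> c r r0 hD.
have hU (w : Cplx R) : nrm w <= 1 -> U (a + c *: b + w *: (r%:C *: b)).
  move=> w1; rewrite -addrA scalerA -scalerDl; apply: hD => /=.
  rewrite addrAC subrr add0r nrmE lecR nrmM nrm_realC gtr0_norm//.
  by rewrite ler_piMl// ltW.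
have -> : (fun t : R => ((EFin \o v) (a + (c + ((r * cos t) +i* (r * sin t))%C) *: b))) =
    (fun t => (v (a + c *: b + cis t *: (r%:C *: b)))%:E).
  apply/funext => t; rewrite -addrA scalerA -scalerDl /=; congr (v (a + (c + _) *: b))%:E.
  by apply/eqP; rewrite eq_complex/= !mulr0 !(mulrC r) subr0 add0r !eqxx.
rewrite -circle_meanE ?lee_fin; first exact: sub.
by apply: circle_continuous cv _ => t; apply: hU; rewrite nrm_cis.
Qed.

Lemma cpsh_sub U U' v : U' `<=` U -> cpsh U v -> cpsh U' v.
Proof.
move=> UU [cv sv]; split=> [x /UU/cv//|a b ab]; apply: sv => w w1.
by apply: UU; exact: ab.
Qed.

Let on_circle U a b : (forall w : Cplx R, nrm w <= 1 -> U (a + w *: b)) ->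
  forall t, U (a + cis t *: b).
Proof. by move=> ab t; apply: ab; rewrite nrm_cis. Qed.

Lemma cpsh_cst U (c : R) : cpsh U (cst c).
Proof.
split=> [x _|a b _]; first exact: (@cst_continuous V R c x).
by rewrite -[leRHS]/(circle_mean (cst c)) circle_mean_cst.
Qed.

Lemma cpshD U v v' : cpsh U v -> cpsh U v' -> cpsh U (fun x => v x + v' x).
Proof.
move=> [cv sv] [cv' sv']; split=> [x Ux|a b ab].
  exact: (cvgD (cv _ Ux) (cv' _ Ux)).
rewrite circle_meanD; first by rewrite lerD ?sv ?sv'.
  exact: circle_continuous cv (on_circle ab).
exact: circle_continuous cv' (on_circle ab).
Qed.

Lemma cpshZ U (c : R) v : 0 <= c -> cpsh U v -> cpsh U (fun x => c * v x).
Proof.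
move=> c0 [cv sv]; split=> [x Ux|a b ab].
  exact: (cvgMl_tmp (cv _ Ux)).
rewrite circle_meanZ ?ler_wpM2l ?sv//.
exact: circle_continuous cv (on_circle ab).
Qed.

Lemma cpsh_max U v v' : cpsh U v -> cpsh U v' ->
  cpsh U (fun x => Order.max (v x) (v' x)).
Proof.
move=> [cv sv] [cv' sv'].
have cm x : U x -> {for x, continuous (fun x => Order.max (v x) (v' x))}.
  by move=> Ux; apply: continuous_max; [exact: cv|exact: cv'].
split=> // a b ab; have cc := circle_continuous cm (on_circle ab).
rewrite ge_max; apply/andP; split.
  apply: (le_trans (sv _ _ ab)); apply: le_circle_mean => //.
    exact: circle_continuous cv (on_circle ab).
  by move=> t; rewrite le_max lexx.
apply: (le_trans (sv' _ _ ab)); apply: le_circle_mean => //.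
  exact: circle_continuous cv' (on_circle ab).
by move=> t; rewrite le_max lexx orbT.
Qed.

(** On each affine disc the local inequalities are those required by
    [disc_mean]. *)
Lemma cpsh_local U v :
  (forall x, U x -> exists O v', [/\ open O, O x, cpsh O v' & forall y, O y -> v y = v' y]) ->
  cpsh U v.
Proof.
move=> loc; have cv x : U x -> {for x, continuous v}.
  move=> /loc[W [v' [oW Wx [cv' _] vv']]].
  have nW : nbhs x W by exact: open_nbhs_nbhs.
  move=> A; rewrite vv'// => /(cv' x Wx) h.
  by apply: filterS2 nW h => y Wy /=; rewrite vv'.
split=> // a b ab.

have := @disc_mean R (fun w => v (a + w *: b)).
rewrite scale0r addr0; apply.
  move=> w /ab Uw.
  apply: (@continuous_comp _ _ _ (fun w : Cplx R => a + w *: b) v); last exact: cv.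
  exact: slice_continuous.
move=> p /ltW/ab/loc[W [v' [oW Wx [cv' sv'] vv']]].
have [r r0 rW] := (nbhs_nrmP _ _).1 (open_nbhs_nbhs (conj oW Wx)).
have nb : 0 < nrm b + 1 by rewrite ltr_wpDl ?nrm_ge0.
exists (r / (nrm b + 1)); first by rewrite divr_gt0.
move=> d; rewrite ltr_pdivlMr// => dr.
have hW (w : Cplx R) : nrm w <= 1 -> W (a + p *: b + w *: (d *: b)).
  move=> w1; apply: rW; rewrite opprD addrA subrr add0r nrmN !nrmZ.
  apply: le_lt_trans dr; apply: (@le_trans _ _ (nrm d * nrm b)).
    by rewrite ler_piMl ?mulr_ge0 ?nrm_ge0.
  by rewrite ler_wpM2l ?nrm_ge0// lerDl.
have -> : (fun t => v (a + (p + cis t * d) *: b)) =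
    (fun t => v' (a + p *: b + cis t *: (d *: b))).
  apply/funext => t; rewrite -vv'; last exact: on_circle hW t.
  by rewrite scalerDl scalerA addrA.
by rewrite vv'//; exact: sv'.
Qed.

End cpsh.

(** * Edwards' duality *)

Section psh_o.
Variables (R : realType) (n : nat) (X : set (Cspace R n)).
Local Notation V := (Cspace R n).
Implicit Types (u v : V -> R).

Lemma psh_oP u : psh_o X u <->
  exists U v, [/\ open U, X `<=` U, cpsh U v & forall z, X z -> v z = u z].
Proof.
split=> [[U [v [oU XU pv cv vu]]]|[U [v [oU XU pv vu]]]]; exists U, v.
  by split=> //; apply/cpshP.
by have [] := (cpshP v oU).2 pv.
Qed.

Lemma psh_o_continuous u : psh_o X u -> {within X, continuous u}.
Proof.
move=> /psh_oP[U [v [oU XU [cv _] vu]]].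
apply: (@subspace_eq_continuous _ X _ v u).
  by move=> x /set_mem Xx; exact: vu.
apply/subspace_continuousP => x Xx; apply: cvg_within_filter.
exact/cv/XU.
Qed.

Lemma psh_o_cst (c : R) : psh_o X (cst c).
Proof.
apply/psh_oP; exists setT, (cst c); split => //; first exact: openT.
exact: cpsh_cst.
Qed.

Lemma psh_oD u v : psh_o X u -> psh_o X v -> psh_o X (fun x => u x + v x).
Proof.
move=> /psh_oP[U [u' [oU XU pu uu]]] /psh_oP[W [v' [oW XW pv vv]]].
apply/psh_oP; exists (U `&` W), (fun x => u' x + v' x); split.
- exact: openI.
- by move=> x Xx; split; [exact: XU|exact: XW].
- by apply: cpshD; [apply: cpsh_sub pu|apply: cpsh_sub pv]; apply: subIset; [left|right].
- by move=> z Xz; rewrite uu ?vv.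
Qed.

Lemma psh_oZ (c : R) u : 0 <= c -> psh_o X u -> psh_o X (fun x => c * u x).
Proof.
move=> c0 /psh_oP[U [u' [oU XU pu uu]]].
apply/psh_oP; exists U, (fun x => c * u' x); split => //; first exact: cpshZ.
by move=> z Xz; rewrite uu.
Qed.

Lemma psh_o_max u v : psh_o X u -> psh_o X v ->
  psh_o X (fun x => Order.max (u x) (v x)).
Proof.
move=> /psh_oP[U [u' [oU XU pu uu]]] /psh_oP[W [v' [oW XW pv vv]]].
apply/psh_oP; exists (U `&` W), (fun x => Order.max (u' x) (v' x)); split.
- exact: openI.
- by move=> x Xx; split; [exact: XU|exact: XW].
- by apply: cpsh_max; [apply: cpsh_sub pu|apply: cpsh_sub pv]; apply: subIset; [left|right].
- by move=> z Xz; rewrite uu ?vv.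
Qed.

Hypothesis cX : compact X.

(** The functional p h is the infimum at z of the functions - psi above h, with
    psi in PSH^o(X). A linear functional below p is positive and dominates
    evaluation at z on PSH^o(X), so the measure that represents it is a Jensen
    measure for z. Choosing it to agree with p at - f turns the hypothesis on
    Jensen measures into c <= - p (- f), which is the conclusion up to e. *)
Lemma edwards (z : V) (f : V -> R) (c e : R) : X z ->
  {within X, continuous f} ->
  (forall mu, jensen X z mu -> (c%:E <= \int[mu]_(x in X) (f x)%:E)%E) ->
  0 < e ->
  exists2 psi, psh_o X psi & (forall x, X x -> psi x <= f x) /\ c - e < psi z.
Proof.
move=> Xz cf hf e0.
pose below (h : V -> R) := [set - psi z | psi in
  [set psi | psh_o X psi /\ forall x, X x -> h x <= - psi x]].
pose p h := inf (below h).
pose D := @bounded_on V R X.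
have below0 h : D h -> below h !=set0.
  move=> [K hK]; exists (- (- K)), (cst (- K)) => //; split; first exact: psh_o_cst.
  by move=> x Xx; rewrite opprK; apply: le_trans (hK _ Xx); exact: ler_norm.
have lb_below h : lbound (below h) (h z).
  by move=> _ [psi [_ hpsi] <-]; exact: hpsi.
have p_le h psi : psh_o X psi -> (forall x, X x -> h x <= - psi x) -> p h <= - psi z.
  by move=> ppsi hpsi; apply: ge_inf; [exists (h z); exact: lb_below|exists psi].
have sp : sublinear_on D p.
  split=> [h k Dh Dk|t h t0 Dh].
    rewrite -lerBlDr; apply: lb_le_inf; first exact: below0.
    move=> _ [psi [ppsi hpsi] <-].
    rewrite lerBlDr -lerBlDl; apply: lb_le_inf; first exact: below0.
    move=> _ [chi [pchi hchi] <-]; rewrite lerBlDl.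
    rewrite -opprD; apply: (p_le _ (fun x => psi x + chi x)); first exact: psh_oD.
    by move=> x Xx; rewrite opprD; apply: lerD; [exact: hpsi|exact: hchi].
  move: t0; rewrite le_eqVlt => /predU1P[<-|t0].
    rewrite mul0r scale0r -[leRHS]oppr0; apply: (p_le _ (cst 0)); first exact: psh_o_cst.
    by move=> x _; rewrite oppr0.
  rewrite -ler_pdivrMl//; apply: lb_le_inf; first exact: below0.
  move=> _ [psi [ppsi hpsi] <-]; rewrite ler_pdivrMl// mulrN.
  apply: (p_le _ (fun x => t * psi x)); first exact: psh_oZ (ltW t0) ppsi.
  by move=> x Xx; rewrite -mulrN -[(t *: h) x]/(t * h x) ler_wpM2l ?(ltW t0) ?hpsi.
have D0 : D 0 by exact: bounded_on_cst.
have DD h k : D h -> D k -> D (h + k) by exact: bounded_onD.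
have DZ t h : D h -> D (t *: h) by exact: bounded_onZ.
have bf : D f by exact: continuous_compact_bounded.
have [L [LD LZ Lp Lf]] := hahn_banach D0 DD DZ sp (DZ (-1) _ bf).
have L_le h psi : D h -> psh_o X psi -> (forall x, X x -> h x <= - psi x) -> L h <= - psi z.
  by move=> Dh ppsi hpsi; apply: le_trans (Lp _ Dh) _; exact: p_le.
have LN h : D h -> L (- h) = - L h.
  by move=> Dh; rewrite -scaleN1r LZ// mulN1r.
have DN h : D h -> D (- h) by move=> Dh; rewrite -scaleN1r; exact: DZ.
have L_ge0 h : bounded_on X h -> (forall x, X x -> 0 <= h x) -> 0 <= L h.
  move=> Dh h0; rewrite -oppr_le0 -LN//.
  have <- : - (cst 0 z : R) = 0 by rewrite oppr0.
  apply: L_le; [exact: DN|exact: psh_o_cst|].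
  by move=> x Xx; rewrite -[(- h) x]/(- h x) oppr0 oppr_le0 h0.
have D1 : D (cst 1) by exact: bounded_on_cst.
have L1 : L (cst 1) = 1.
  apply/eqP; rewrite eq_le; apply/andP; split.
    rewrite -[leRHS]opprK; apply: (L_le _ (cst (-1))) => //; first exact: psh_o_cst.
    by move=> x _; rewrite /cst opprK.
  rewrite -lerN2 -LN//; apply: (L_le _ (cst 1)) => //; [exact: DN|exact: psh_o_cst].
have [P [PX oP iP LP]] := riesz_domination (@hausdorff_nrm _ V) cX LD LZ L_ge0 L1.
have jP : jensen X z P.
  split => //.
    by move=> A mA; split; [exact: oP|exact: iP].
  move=> psi ppsi; have cpsi := psh_o_continuous ppsi.
  apply: le_trans (LP _ cpsi); rewrite lee_fin -lerN2 -LN; last exact: continuous_compact_bounded.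
  by apply: L_le => //; apply: DN; exact: continuous_compact_bounded.
have cL : c <= L f.
  have cNf : {within X, continuous (- f)} by move=> x; apply: cvgN; exact: cf.
  have := LP _ cNf; rewrite LN// => h.
  have iPf : P.-integrable X (EFin \o f).
    by apply: continuous_compact_integrable_prob => //; exact: hausdorff_nrm.
  have mX := compact_borel (@hausdorff_nrm _ V) cX.
  have fin : (\int[P]_(x in X) (f x)%:E \is a fin_num)%E by exact: integrable_fin_num.
  move: h; rewrite (_ : (\int[P]_(x in X) ((- f) x)%:E = - \int[P]_(x in X) (f x)%:E)%E); last first.
    by rewrite -integralN//=; exact: integrable_add_def.
  have := hf _ jP; rewrite -(fineK fin) -EFinN !lee_fin; lra.
have pf : p (- f) < - (c - e).
  by rewrite -scaleN1r -Lf LZ// mulN1r; lra.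
have [_ [psi [ppsi hpsi] <-] hlt] : exists2 y, below (- f) y & y < - (c - e).
  by apply: inf_lt pf; apply: below0; exact: DN.
exists psi => //; split; last by rewrite ltrN2 in hlt.
by move=> x Xx; have := hpsi _ Xx; rewrite -[(- f) x]/(- f x) lerN2.
Qed.

(** PSH^o(X) is stable by maxima, so the minorants obtained at the various points
    form a directed family and compactness selects one of them. *)
Lemma edwards_uniform (f g : V -> R) (e : R) :
  {within X, continuous f} -> usc_on X (EFin \o g) ->
  (forall z, X z -> forall mu, jensen X z mu ->
     ((g z)%:E <= \int[mu]_(x in X) (f x)%:E)%E) ->
  0 < e ->
  exists2 psi, psh_o X psi & forall x, X x -> g x - e < psi x <= f x.
Proof.
move=> cf ug gf e0.
have [K fK] := continuous_compact_bounded cX cf.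
have [||z Xz|psi [ppsi psif] gpsi] := @compact_directed V X (V -> R)
   [set psi | psh_o X psi /\ forall x, X x -> psi x <= f x]
   (fun psi x => g x - e < psi x) cX.
- exists (cst (- K)); split; first exact: psh_o_cst.
  by move=> x /fK; rewrite ler_norml => /andP[].
- move=> psi chi [ppsi psif] [pchi chif].
  exists (fun x => Order.max (psi x) (chi x)).
    split; first exact: psh_o_max.
    by move=> x Xx; rewrite ge_max psif ?chif.
  by move=> x Xx; rewrite lt_max => -[->|->]; rewrite ?orbT.
- have e2 : 0 < e / 2 by rewrite divr_gt0.
  have [psi ppsi [psif gpsi]] := edwards Xz cf (gf z Xz) e2.
  exists psi => //.
  pose d := (psi z - (g z - e)) / 2.
  have d0 : psi z - d < psi z by rewrite /d; lra.
  have gd : ((g z)%:E < (g z + d)%:E)%E by rewrite lte_fin /d; lra.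
  have cpsi := (subspace_continuousP _ _).1 (psh_o_continuous ppsi) z Xz.
  have h1 : nbhs z [set y | X y -> psi z - d < psi y] := cpsi _ (lt_nbhsr d0).
  have h2 : nbhs z [set y | X y -> ((g y)%:E < (g z + d)%:E)%E] := (ug z Xz).2 _ gd.
  apply: filterS2 h1 h2 => y /= + + Xy => /(_ Xy) h1 /(_ Xy); rewrite lte_fin.
  by rewrite /d in h1 *; lra.
by exists psi => // x Xx; rewrite gpsi// psif.
Qed.

End psh_o.

(** * Sup-convolution *)

Section sup_convolution.
Variables (R : realType) (V : normedModType (Cplx R)) (K : set V) (g : V -> R) (C : R).
Hypotheses (K0 : K !=set0) (gC : forall x, K x -> g x <= C).

(** The smallest k-Lipschitz function above g on K. *)
Definition sup_conv (k : R) (x : V) : R :=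
  sup [set g y - k * nrm (x - y) | y in K].

Let ubd k x : 0 <= k -> ubound [set g y - k * nrm (x - y) | y in K] C.
Proof.
move=> k0 _ [y Ky <-]; have := gC Ky; have := mulr_ge0 k0 (nrm_ge0 (x - y)); lra.
Qed.

Lemma sup_conv_ge k x y : 0 <= k -> K y -> g y - k * nrm (x - y) <= sup_conv k x.
Proof. by move=> k0 Ky; apply: ub_le_sup; [exists C; exact: ubd|exists y]. Qed.

Lemma sup_conv_le k x (a : R) :
  (forall y, K y -> g y - k * nrm (x - y) <= a) -> sup_conv k x <= a.
Proof.
move=> ha; apply: ge_sup; last by move=> _ [y Ky <-]; exact: ha.
by case: K0 => y Ky; exists (g y - k * nrm (x - y)), y.
Qed.

Lemma sup_conv_ge_self k x : 0 <= k -> K x -> g x <= sup_conv k x.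
Proof. by move=> k0 Kx; have := sup_conv_ge x k0 Kx; rewrite subrr nrm0 mulr0 subr0. Qed.

Lemma sup_conv_antitone k l x : 0 <= k -> k <= l -> sup_conv l x <= sup_conv k x.
Proof.
move=> k0 kl; apply: sup_conv_le => y Ky; apply: le_trans (sup_conv_ge x k0 Ky).
by rewrite lerD2l lerN2 ler_wpM2r ?nrm_ge0.
Qed.

Lemma sup_conv_continuous k : 0 <= k -> continuous (sup_conv k).
Proof.
move=> k0; apply: (@lipschitz_continuous _ _ k) => x y; apply: sup_conv_le => z Kz.
have := sup_conv_ge x k0 Kz; have := ler_wpM2l k0 (ler_dist_nrmD x y z).
rewrite mulrDr; lra.
Qed.

(** Sup-convolutions decrease to an upper semicontinuous g, and this is uniform
    on compact sets in the sense of Dini: near x the values g y with y close to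
    x are below q, and those with y at distance at least r from x are lowered by
    an amount of order k r. *)
Lemma sup_conv_lt (Q : set V) (q : V -> R) :
  compact Q -> {within Q, continuous q} -> usc_on K (EFin \o g) -> Q `<=` K ->
  (forall x, Q x -> g x < q x) ->
  exists2 k0, 0 <= k0 & forall k, k0 <= k -> forall x, Q x -> sup_conv k x < q x.
Proof.
move=> cQ cq ug QK gq.
have [||x Qx|k0 k00 hk] := @compact_directed V Q R [set k | 0 <= k]
  (fun k x => sup_conv k x < q x) cQ.
- by exists 0 => /=.
- move=> i j /= i0 j0; exists (Order.max i j) => /=; first by rewrite le_max i0.
  by move=> x _ [] h; apply: le_lt_trans h; apply: sup_conv_antitone => //;
    rewrite le_max lexx ?orbT.
- pose d := (q x - g x) / 2.
  have d0 : 0 < d by rewrite divr_gt0// subr_gt0 gq.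
  have gd : ((g x)%:E < (g x + d)%:E)%E by rewrite lte_fin ltrDl.
  have qd : q x - d < q x by rewrite gtrBl.
  have h1 : nbhs x [set y | K y -> ((g y)%:E < (g x + d)%:E)%E] := (ug x (QK _ Qx)).2 _ gd.
  have cqx := (subspace_continuousP _ _).1 cq x Qx.
  have h2 : nbhs x [set y | Q y -> q x - d < q y] := cqx _ (lt_nbhsr qd).
  have /nbhs_nrmP[r r0 hr] := h1; have /nbhs_nrmP[s s0 hs] := h2.
  pose k := 2 * (`|C - g x| + 1) / r.
  have k0 : 0 < k by rewrite divr_gt0// mulr_gt0// ltr_wpDl.
  exists k; first exact: ltW.
  have m0 : 0 < Order.min s (r / 2) by rewrite lt_min s0 divr_gt0.
  apply/nbhs_nrmP; exists (Order.min s (r / 2)) => // x'.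
  rewrite lt_min => /andP[xs xr] Qx'.
  apply: (@le_lt_trans _ _ (g x + d)); last first.
    have := hs _ xs Qx'; rewrite /d; lra.
  apply: sup_conv_le => y Ky; have [xy|xy] := ltP (nrm (x - y)) r.
    have /= := hr _ xy Ky; rewrite lte_fin.
    have := mulr_ge0 (ltW k0) (nrm_ge0 (x' - y)); lra.
  have hy : r / 2 <= nrm (x' - y) by have := ler_dist_nrmD x x' y; lra.
  have := ler_wpM2l (ltW k0) hy.
  have -> : k * (r / 2) = `|C - g x| + 1 by rewrite /k; field; rewrite gt_eqF.
  have := ler_norm (C - g x); have := gC Ky; lra.
exists k0 => // k kk x /hk; apply: le_lt_trans.
exact: sup_conv_antitone.
Qed.

End sup_convolution.

Section sup_conv_psh.
Variables (R : realType) (n : nat).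
Local Notation V := (Cspace R n).
Variables (Omega K : set V) (u : V -> \bar R) (g : V -> R) (C M : R).
Hypotheses (OK : Omega `<=` K) (pu : psh Omega u)
  (gE : forall x, K x -> (g x)%:E = maxe (u x) (- M)%:E)
  (gC : forall x, K x -> g x <= C).

Let gM x : K x -> - M <= g x.
Proof. by move=> Kx; rewrite -lee_fin gE// le_max lexx orbT. Qed.

Let ug x : K x -> (u x <= (g x)%:E)%E.
Proof. by move=> Kx; rewrite gE// le_max lexx. Qed.

(** When k rho exceeds the oscillation of g, the points y farther than rho from x
    do not contribute. The others are translates x + omega, so locally the
    sup-convolution is a supremum of translates of g minus constants. The mean
    inequality of u on a translated circle is compared directly with the
    sup-convolution, whose continuity takes care of measurability. *)
Lemma sup_conv_cpsh_ball (x0 : V) (rho k : R) : 0 < rho -> 0 <= k ->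
  C + M < k * rho ->
  (forall y, nrm (x0 - y) < 2 * rho -> Omega y) ->
  cpsh [set x | nrm (x0 - x) < rho] (sup_conv K g k).
Proof.
move=> rho0 k0 kC ball2; set h := sup_conv K g k.
have ball1 x : nrm (x0 - x) < rho -> Omega x by move=> xr; apply: ball2; lra.
have K0 : K !=set0 by exists x0; apply/OK/ball1; rewrite subrr nrm0.
have ch : continuous h by exact: sup_conv_continuous gC _ k0.
split=> [x _|a b ab]; first exact: ch.
have ab1 t : nrm (x0 - (a + cis t *: b)) < rho by apply: ab; rewrite nrm_cis.
set m := circle_mean _.
have cc : continuous (fun t : R => h (a + cis t *: b)).
  by apply: (@circle_continuous _ _ setT) => // x _; exact: ch.
have Mm : - M <= m.
  rewrite -(circle_mean_cst (- M)); apply: le_circle_mean => // [t|t].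
    exact: cvg_cst.
  have Kt : K (a + cis t *: b) by apply/OK/ball1/ab1.
  exact: le_trans (gM Kt) (sup_conv_ge_self gC k0 Kt).
apply: sup_conv_le => // y Ky; have [ay|ay] := leP rho (nrm (a - y)).
  have := ler_wpM2l k0 ay; have := gC Ky; lra.
have knn : 0 <= k * nrm (a - y) by rewrite mulr_ge0// nrm_ge0.
rewrite lerBlDr -lee_fin gE// ge_max; apply/andP; split; last first.
  by rewrite lee_fin; lra.
have yb (w : Cplx R) : nrm w <= 1 -> Omega (y + w *: b).
  move=> w1; apply: ball2; have := ab _ w1.
  have := ler_dist_nrmD x0 (a + w *: b) (y + w *: b).
  by rewrite opprD addrACA subrr addr0 /=; lra.
apply: (le_trans (psh_le_mean pu yb)).
have -> : m + k * nrm (a - y) = circle_mean (fun t => h (a + cis t *: b) + k * nrm (a - y)).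
  by rewrite circle_meanD// ?circle_mean_cst// => t; exact: cvg_cst.
rewrite circle_meanE; last first.
  by move=> t; apply: cvgD; [exact: cc|exact: cvg_cst].
apply: lee_wpmul2l; first by rewrite lee_fin invr_ge0 mulr_ge0 ?pi_ge0.
apply: le_integral_pointwise => t _.
have Kt : K (y + cis t *: b) by apply/OK/yb; rewrite nrm_cis.
apply: (le_trans (ug Kt)); rewrite lee_fin -lerBlDr.
have := sup_conv_ge gC (a + cis t *: b) k0 Kt.
by rewrite opprD addrACA subrr addr0.
Qed.

Lemma sup_conv_cpsh (L : set V) : open Omega -> compact L -> L `<=` Omega ->
  exists2 k0, 0 <= k0 & forall k, k0 <= k ->
    exists W, [/\ open W, L `<=` W & cpsh W (sup_conv K g k)].
Proof.
move=> oO cL LO.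
have [||x Lx|rho rho0 hrho] := @compact_directed V L R [set r | 0 < r]
  (fun r x => forall y, nrm (x - y) < 2 * r -> Omega y) cL.
- by exists 1 => /=.
- move=> i j /= i0 j0; exists (Order.min i j) => /=; first by rewrite lt_min i0.
  move=> x _ [] h y xy; apply: h; apply: (lt_le_trans xy);
  by rewrite ler_pM2l// ge_min lexx ?orbT.
- have /nbhs_nrmP[r r0 hr] := open_nbhs_nbhs (conj oO (LO _ Lx)).
  exists (r / 4) => /=; first by rewrite divr_gt0.
  apply/nbhs_nrmP; exists (r / 2); first by rewrite divr_gt0.
  move=> x' xx' _ y xy; apply: hr.
  by have := ler_dist_nrmD x x' y; lra.
exists ((`|C + M| + 1) / rho).
  by rewrite divr_ge0 ?(ltW rho0)// addr_ge0.
move=> k kk; have k0 : 0 <= k.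
  by apply: le_trans kk; rewrite divr_ge0 ?(ltW rho0)// addr_ge0.
have kC : C + M < k * rho.
  move: kk; rewrite ler_pdivrMr// => kk; apply: lt_le_trans kk.
  by have := ler_norm (C + M); lra.
exists (\bigcup_(x in L) [set y | nrm (x - y) < rho]); split.
- by apply: bigcup_open => x Lx; exact: open_nrm_ball.
- by move=> x Lx; exists x => //=; rewrite subrr nrm0.
- apply: cpsh_local => y [x Lx xy]; exists [set y | nrm (x - y) < rho], (sup_conv K g k).
  split => //; first exact: open_nrm_ball.
  exact: sup_conv_cpsh_ball (hrho _ Lx).
Qed.

End sup_conv_psh.

(** * Hyperconvex domains and gluing *)

Section hyperconvex_domain.
Variables (R : realType) (n : nat).
Local Notation V := (Cspace R n).

Lemma compact_nrm_ball (r : R) : compact [set x : V | nrm x <= r].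
Proof.
have cD : compact [set v : V | forall i, disc (r + 1) (v ord0 i)].
  exact: (@rV_compact (Cplx R) n (fun=> @disc R (r + 1)) (fun i => @compact_disc R (r + 1))).
apply: subclosed_compact cD _.
  exact: closed_nrm_ball.
move=> v /= vr i; have : ball (0 : V) ((r + 1)%:C : Cplx R) v.
  by rewrite -ball_normE/= sub0r normrN nrmE ltcR (le_lt_trans vr)// ltrDl.
move=> [_ /(_ ord0 i)]; rewrite -ball_normE/= mxE sub0r normrN nrmE ltcR.
exact: ltW.
Qed.

Lemma compact_closure (A : set V) : bounded_set A -> compact (closure A).
Proof.
move=> [r [rr hr]].
have : forall x, A x -> `|x| <= r + 1 by apply: hr; rewrite ltrDl.
have r1 : (r + 1 : Cplx R) = (complex.Re ((r + 1) : R[i]))%:C.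
  by rewrite [RHS]RRe_real// realD// real1.
rewrite r1; set s := complex.Re _ => hA.
apply: (subclosed_compact _ (@compact_nrm_ball s)); first exact: closed_closure.
apply: (@subset_trans _ (closure [set x : V | nrm x <= s])).
  by apply: closure_subset => x /hA; rewrite nrmE lecR.
rewrite -(closure_id _).1//.
exact: closed_nrm_ball.
Qed.

Lemma continuous_at_open (W K : set V) (v : V -> R) : open W -> W `<=` K ->
  {within K, continuous v} -> forall x, W x -> {for x, continuous v}.
Proof.
move=> oW WK /subspace_continuousP cv x Wx A /(cv x (WK _ Wx)) h.
have nW : nbhs x W by exact: open_nbhs_nbhs.
by apply: filterS2 nW h => y Wy; apply; exact: WK.
Qed.

Lemma cpsh_uniform_limit (W K : set V) (v : V -> R) : open W -> W `<=` K ->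
  {within K, continuous v} ->
  (forall e, 0 < e -> exists2 p, psh_o K p & forall x, K x -> v x - e < p x <= v x) ->
  cpsh W v.
Proof.
move=> oW WK cv app; have cvW := continuous_at_open oW WK cv.
split=> // a b ab; apply/ler_addgt0Pr => e e0.
have [p /psh_oP[U [q [oU KU pq qp]]] pv] := app e e0.
have abU (w : Cplx R) : nrm w <= 1 -> U (a + w *: b) by move=> /ab/WK/KU.
have Ka : K a by have := WK _ (ab 0 _); rewrite scale0r addr0; apply; rewrite nrm0.
have := pq.2 a b abU; rewrite qp// => h.
have /andP[va _] := pv _ Ka.
suff : circle_mean (fun t => q (a + cis t *: b)) <= circle_mean (fun t => v (a + cis t *: b)).
  by lra.
have ab1 t : W (a + cis t *: b) by apply: ab; rewrite nrm_cis.
apply: le_circle_mean => [||t].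
- apply: circle_continuous pq.1 _ => t; exact/KU/WK/ab1.
- exact: circle_continuous cvW ab1.
- by rewrite qp; [have /andP[] := pv _ (WK _ (ab1 t))|exact/WK].
Qed.

(** The set where the maximum is attained is closed, and it is open because a - b
    is opposite to a + b on the circle of center a and direction b. *)
Lemma cpsh_strong_max (W : set V) (v : V -> R) (y : V) : open W -> connected W ->
  cpsh W v -> W y -> (forall x, W x -> v x <= v y) -> forall x, W x -> v x = v y.
Proof.
move=> oW cW [cv sv] Wy vy.
pose B := W `&` [set x | v x = v y].
suff -> : W = B by move=> x [].
apply/esym; apply: cW.
- by exists y.
- exists B; last by rewrite /B setIA setIid.
  rewrite openE => a [Wa va].
  have /nbhs_nrmP[r r0 hr] := open_nbhs_nbhs (conj oW Wa).
  apply/nbhs_nrmP; exists r => // c ac; split; first exact: hr.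
  have ab (w : Cplx R) : nrm w <= 1 -> W (a + w *: (a - c)).
    move=> w1; apply: hr; rewrite opprD addrA subrr add0r nrmN nrmZ.
    by apply: le_lt_trans ac; rewrite ler_piMl ?nrm_ge0.
  have ab1 t : W (a + cis t *: (a - c)) by apply: ab; rewrite nrm_cis.
  have := @circle_mean_max_pi R (fun t => v (a + cis t *: (a - c))) (v y).
  rewrite cispi scaleN1r opprB addrCA subrr addr0; apply.
  + exact: circle_continuous cv ab1.
  + by move=> t; exact/vy/ab1.
  + by rewrite -va; exact: sv.
- exists (closure B); first exact: closed_closure.
  apply/seteqP; split=> x; first by move=> Bx; split; [case: Bx|exact: subset_closure].
  move=> [Wx cBx]; split => //=; apply/eqP; rewrite eq_le vy//= leNgt; apply/negP => vxy.
  by have [z [[_ /= ->]]] := cBx _ (cv x Wx _ (lt_nbhsl vxy)); rewrite /= ltxx.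
Qed.

Lemma psh_o_local (X : set V) (w : V -> R) :
  (forall x, X x -> exists W v', [/\ open W, W x, cpsh W v' & forall y, W y -> w y = v' y]) ->
  psh_o X w.
Proof.
move=> loc; apply/psh_oP.
pose U : set V := [set x | exists W v',
   [/\ open W, W x, cpsh W v' & forall y, W y -> w y = v' y]].
exists U, w; split => //; last exact: cpsh_local.
rewrite openE => x [W [v' [oW Wx pv wv]]].
have nW : nbhs x W by exact: open_nbhs_nbhs.
by apply: filterS nW => y Wy; exists W, v'.
Qed.

Section hyperconvex.
Variables (Omega : set V) (phi : V -> R).
Local Notation K := (closure Omega).
Local Notation B := (boundary Omega).
Hypotheses (oO : open Omega) (cO : connected Omega) (bO : bounded_set Omega).
Hypotheses (pphi : psh_compact K (EFin \o phi)) (cphi : {within K, continuous phi})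
  (nphi : exists x y, [/\ K x, K y & phi x <> phi y])
  (phi0 : forall z, B z -> phi z = 0).

Lemma closure_boundary x : K x -> ~ B x -> Omega x.
Proof.
move=> Kx nBx; apply: contrapT => nOx; apply: nBx; split => //.
by move=> /interior_subset.
Qed.

Lemma boundary_closure : B `<=` K. Proof. by move=> x []. Qed.

Let cK : compact K. Proof. exact: compact_closure. Qed.

Lemma compact_boundary : compact B.
Proof.
apply: compact_closedI => //; apply: open_closedC; exact: open_interior.
Qed.

Lemma phi_approx (e : R) : 0 < e ->
  exists2 p, psh_o K p & forall x, K x -> phi x - e < p x <= phi x.
Proof.
move=> e0; apply: edwards_uniform => //; first exact: continuous_usc_on.
by move=> z Kz mu jmu; exact: pphi.2.
Qed.

(** Being a uniform limit of functions of PSH^o(K), phi is plurisubharmonic in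
    Omega. If phi were nonnegative somewhere in Omega it would attain its maximum
    there, since it vanishes on the boundary, and it would be constant. *)
Lemma phi_lt0 x : Omega x -> phi x < 0.
Proof.
move=> Ox; rewrite ltNge; apply/negP => phix.
have Kx : K x by exact: subset_closure.
have [c Kc cmax] := compact_max cK (ex_intro _ x Kx) cphi.
have [y Oy ymax] : exists2 y, Omega y & forall z, K z -> phi z <= phi y.
  have [Bc|nBc] := pselect (B c); last by exists c => //; exact: closure_boundary.
  exists x => // z Kz; apply: le_trans phix; rewrite -(phi0 Bc); exact: cmax.
have pO : cpsh Omega phi.
  exact: cpsh_uniform_limit oO (@subset_closure _ _) cphi phi_approx.
have phiO : forall z, Omega z -> phi z = phi y.
  apply: cpsh_strong_max => // z Oz; apply: ymax; exact: subset_closure.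
have phiK z : K z -> phi z = phi y.
  move=> Kz; apply/eqP; rewrite eq_le ymax//= leNgt; apply/negP => zy.
  have h : nbhs z [set t | K t -> phi t < phi y].
    exact: ((subspace_continuousP _ _).1 cphi z Kz _ (lt_nbhsl zy)).
  have [t [Ot /(_ (subset_closure Ot))]] := Kz _ h.
  by rewrite phiO// ltxx.
by have [a [b [Ka Kb]]] := nphi; rewrite !phiK.
Qed.

Section gluing.
Variables (u : V -> \bar R) (f g : V -> R) (C M k1 e : R) (v : V -> R).
Hypotheses (pu : psh Omega u) (ug : usc_on K (EFin \o g))
  (gE : forall x, K x -> (g x)%:E = maxe (u x) (- M)%:E)
  (gC : forall x, K x -> g x <= C)
  (cf : continuous f) (fC : forall x, K x -> f x <= C)
  (k10 : 0 <= k1) (hf1 : forall x, K x -> sup_conv K g k1 x <= f x) (e0 : 0 < e) (K0 : K !=set0)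
  (pv : psh_o B v) (gv : forall x, B x -> g x - e < v x <= f x).

(** The gluing. With v1 = v + 2 e near the boundary and a = v1 + A p:
    - where phi > - s, the term A p is above - e / 2 and a exceeds h;
    - where phi <= - s, the function h is plurisubharmonic;
    - where phi < - 3 eta, in particular outside N, the choice of A gives
      A p < - A eta, so that a is below -M - 1, hence below h.
    So w, the maximum of those among a and h that are available, is locally
    plurisubharmonic near every point of the closure. *)
Lemma psh_o_between : exists2 w, psh_o K w &
  forall x, K x -> g x <= w x <= f x + 3 * e.
Proof.
have e_gt0 : 0 < e := e0.
have [U0 [v0 [oU0 BU0 pv0 v0v]]] := (psh_oP _ _).1 pv.
have gM x : K x -> - M <= g x by move=> Kx; rewrite -lee_fin gE// le_max lexx orbT.
pose v1 x := v0 x + 2 * e.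
have cv1 x : U0 x -> {for x, continuous v1}.
  by move=> Ux; apply: (cvgD (pv0.1 _ Ux)); exact: (@cst_continuous V R (2 * e) x).
(* A neighbourhood of the boundary on which v1 is controlled from both sides. *)
pose N : set V := [set x | [/\ U0 x, v1 x < C + 3 * e &
   (K x -> g x + e < v1 x) /\ (K x -> v1 x < f x + 3 * e)]]°.
have BN : B `<=` N.
  move=> x Bx; have Kx := boundary_closure Bx.
  have /andP[gvx vfx] := gv Bx.
  have v1x : v1 x = v x + 2 * e by rewrite /v1 v0v.
  have n1 : nbhs x U0 by apply: open_nbhs_nbhs; split => //; exact: BU0.
  have c1 := cv1 _ (BU0 _ Bx).
  pose d := Order.min ((v1 x - g x - e) / 2) (e / 2).
  have [d0 d1 d2] : [/\ 0 < d, d <= (v1 x - g x - e) / 2 & d <= e / 2].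
    split; [|by rewrite ge_min lexx|by rewrite ge_min lexx orbT].
    have h1 : 0 < v1 x - g x - e by rewrite v1x; lra.
    by rewrite lt_min !divr_gt0.
  have v1d : v1 x < v1 x + d by lra.
  have v1d' : v1 x - d < v1 x by lra.
  have n2 : nbhs x [set y | v1 y < v1 x + d] := c1 _ (lt_nbhsl v1d).
  have n3 : nbhs x [set y | v1 x - d < v1 y] := c1 _ (lt_nbhsr v1d').
  have fxd : f x - d < f x by lra.
  have n4 : nbhs x [set y | f x - d < f y] := cf (x := x) (lt_nbhsr fxd).
  have n5 : nbhs x [set y | K y -> ((g y)%:E < (g x + d)%:E)%E].
    by apply: (ug Kx).2; rewrite lte_fin; lra.
  have fCx := fC Kx.
  apply: filterS2 (filterI n1 n2) (filterI n3 (filterI n4 n5)).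
  move=> y [U0y /= y1] [/= y2 [/= y3 y4]]; split => //; first by lra.
  by split=> Ky; [have := y4 Ky; rewrite lte_fin|]; lra.
have oN : open N by exact: open_interior.
have NE x : N x -> [/\ U0 x, v1 x < C + 3 * e &
   (K x -> g x + e < v1 x) /\ (K x -> v1 x < f x + 3 * e)].
  exact: interior_subset.
clearbody N.
have phile x : K x -> phi x <= 0.
  move=> Kx; have [Bx|nBx] := pselect (B x); first by rewrite phi0.
  by apply: ltW; apply: phi_lt0; exact: closure_boundary.
(* Outside N, phi is bounded away from 0. *)
have cL : compact (K `\` N) by apply: compact_closedI => //; exact: open_closedC.
have [||x [Kx nNx]|eta eta0 Leta] := @compact_directed V (K `\` N) R [set d | 0 < d]
    (fun d x => phi x < - (3 * d)) cL.
- by exists 1 => /=.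
- move=> i j /= i0 j0; exists (Order.min i j) => /=; first by rewrite lt_min i0.
  move=> x _; have := ge_min i i j; have := ge_min j i j; rewrite !lexx orbT => h1 h2.
  by case; lra.
- have px : phi x < 0 by apply: phi_lt0; apply: closure_boundary => // /BN.
  exists (- phi x / 6) => /=; first by rewrite divr_gt0// oppr_gt0.
  have hx : phi x < - (3 * (- phi x / 6)) by lra.
  have h : nbhs x [set y | K y -> phi y < - (3 * (- phi x / 6))].
    exact: ((subspace_continuousP _ _).1 cphi x Kx _ (lt_nbhsl hx)).
  by apply: filterS h => y h [/h].
rewrite /= in eta0.
(* As v1 < C + 3 e on N, this A brings v1 - A eta below -M - 1. *)
pose A := (C + 3 * e + M + 1) / eta.
have CM : 0 <= C + M by case: K0 => x Kx; have := gM _ Kx; have := gC Kx; lra.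
have A0 : 0 < A by rewrite divr_gt0//; lra.
have Aeta : A * eta = C + 3 * e + M + 1 by rewrite /A divfK ?gt_eqF.
pose s := Order.min eta (e / (4 * A)).
have A4 : 0 < 4 * A by rewrite pmulr_rgt0.
have s0 : 0 < s by rewrite lt_min eta0 divr_gt0.
have s_eta : s <= eta by rewrite ge_min lexx.
have As : A * (2 * s) <= e / 2.
  have : s <= e / (4 * A) by rewrite ge_min lexx orbT.
  rewrite ler_pdivlMr// => sA.
  have -> : A * (2 * s) = s * (4 * A) / 2 by lra.
  by lra.
have [p' pp' p'phi] := phi_approx s0.
have [W0 [p [oW0 KW0 pp pE]]] := (psh_oP _ _).1 pp'.
(* On Q, inside N, h has to be below v1; on L2, inside Omega, h has to be
   plurisubharmonic. Both hold when the constant of h is large. *)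
pose Q := K `&` [set x | ((- (3 * eta))%:E <= (EFin \o phi) x)%E].
have cQ : compact Q by apply: compact_superlevel => //; exact: continuous_usc_on.
have QN : Q `<=` N.
  move=> x [Kx /=]; rewrite lee_fin => h; apply: contrapT => nNx.
  by have := Leta x (conj Kx nNx); lra.
pose L2 := K `&` [set x | (s%:E <= (EFin \o (fun x => - phi x)%R) x)%E].
have cL2 : compact L2.
  apply: compact_superlevel => //; apply: continuous_usc_on => x; apply: cvgN; exact: cphi.
have L2O : L2 `<=` Omega.
  move=> x [Kx /=]; rewrite lee_fin => h; apply: closure_boundary => // /phi0; lra.
have [k2 k20 hk2] : exists2 k, 0 <= k & forall l, k <= l ->
    forall x, Q x -> sup_conv K g l x < v1 x - e / 2.
  apply: (sup_conv_lt K0 gC cQ) => //.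
  - apply/subspace_continuousP => x Qx; apply: cvg_within_filter.
    have U0x : U0 x by have [] := NE _ (QN _ Qx).
    by apply: (cvgB (cv1 _ U0x)); exact: (@cst_continuous V R (e / 2) x).
  - by move=> x [].
  - by move=> x Qx; have [_ _ [/(_ Qx.1) + _]] := NE _ (QN _ Qx); lra.
have [k3 k30 hk3] := sup_conv_cpsh (@subset_closure _ Omega) pu gE gC oO cL2 L2O.
pose k := Order.max k1 (Order.max k2 k3).
have [kk1 kk2 kk3] : [/\ k1 <= k, k2 <= k & k3 <= k].
  by rewrite /k !le_max !lexx !orbT.
have k0 : 0 <= k by exact: le_trans kk1.
have [W2 [oW2 LW2 ph]] := hk3 k kk3.
set h := sup_conv K g k in ph.
have hv1 x : Q x -> h x < v1 x - e / 2 by exact: hk2.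
have hf x : K x -> h x <= f x.
  by move=> Kx; apply: le_trans (hf1 Kx); exact: (sup_conv_antitone K0 gC).
have gh x : K x -> g x <= h x by exact: (sup_conv_ge_self gC).
have ch : continuous h by exact: sup_conv_continuous gC _ k0.
clearbody h.
pose a x := v1 x + A * p x.
have pa : cpsh (U0 `&` W0) a.
  apply: cpshD; last by apply: cpshZ (ltW A0) _; apply: cpsh_sub pp => x [].
  by apply: cpshD; [apply: cpsh_sub pv0 => x []|exact: cpsh_cst].
pose w x := if `[< N x >] then if `[< W2 x >] then Order.max (a x) (h x) else a x
            else h x.
have a_near x : K x -> - s < phi x -> N x /\ h x < a x.
  move=> Kx sx; have Qx : Q x by split => //=; rewrite lee_fin; lra.
  split; first exact: QN.
  have /andP[+ _] := p'phi _ Kx; rewrite -pE// => px.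
  have : A * (- (2 * s)) <= A * p x by rewrite ler_wpM2l ?ltW//; lra.
  by have := hv1 _ Qx; rewrite /a; lra.
have a_le x : K x -> N x -> a x <= f x + 3 * e.
  move=> Kx Nx; have [_ _ [_ /(_ Kx)]] := NE _ Nx.
  have /andP[_] := p'phi _ Kx; rewrite -pE// => px.
  have : A * p x <= 0 by rewrite mulr_ge0_le0 ?(ltW A0)//; have := phile _ Kx; lra.
  by rewrite /a; lra.
exists w; last first.
  move=> x Kx; have hfx := hf _ Kx; have ghx := gh _ Kx; rewrite /w.
  case: asboolP => Nx; last by apply/andP; split; lra.
  have ax := a_le _ Kx Nx.
  case: asboolP => W2x.
    by rewrite le_max ghx orbT ge_max ax/=; lra.
  have [] := a_near _ Kx; last by move=> _ ?; apply/andP; split; lra.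
  rewrite ltNge; apply/negP => xs; apply: W2x; apply: LW2; split => //=.
  by rewrite lee_fin; lra.
apply: psh_o_local => x Kx.
have W0x := KW0 _ Kx.
have [Nx|nNx] := pselect (N x); last first.
  have phix := Leta x (conj Kx nNx).
  have W2x : W2 x by apply: LW2; split => //=; rewrite lee_fin; lra.
  have /andP[_ p'x] := p'phi _ Kx; rewrite -pE// in p'x.
  have n1 : nbhs x (W0 `&` W2) by apply: open_nbhs_nbhs; split; [exact: openI|].
  have px : p x < - eta by lra.
  have hx : - M - 1 < h x by have := gM _ Kx; have := gh _ Kx; lra.
  have n2 : nbhs x [set y | p y < - eta] := pp.1 x W0x _ (lt_nbhsl px).
  have n3 : nbhs x [set y | - M - 1 < h y] := ch x _ (lt_nbhsr hx).
  have n4 := filterI n1 (filterI n2 n3).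
  exists (W0 `&` W2 `&` ([set y | p y < - eta] `&` [set y | - M - 1 < h y]))°, h.
  split; [exact: open_interior|exact: n4| |].
    by apply: cpsh_sub ph => y /interior_subset[[]].
  move=> y /interior_subset[[W0y W2y] [/= py hy]]; rewrite /w.
  case: asboolP => // Ny; case: asboolP => // _.
  have [_ v1y _] := NE _ Ny.
  have : A * p y < A * - eta by rewrite ltr_pM2l.
  by rewrite mulrN Aeta => hA; apply/max_idPr; rewrite /a; lra.
have U0x : U0 x by have [] := NE _ Nx.
have [sx|xs] := ltP (- s) (phi x); last first.
  have W2x : W2 x by apply: LW2; split => //=; rewrite lee_fin; lra.
  exists (N `&` W0 `&` W2), (fun x => Order.max (a x) (h x)); split => //.
  - by apply: openI => //; exact: openI.
  - apply: cpsh_max; [apply: cpsh_sub pa|apply: cpsh_sub ph] => y [[Ny ?] ?] //.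
    by split => //; have [] := NE _ Ny.
  - by move=> y [[Ny _] W2y]; rewrite /w !asboolT.
have [_ hax] := a_near _ Kx sx.
have n1 : nbhs x (N `&` W0) by apply: open_nbhs_nbhs; split; [exact: openI|].
pose b := (a x + h x) / 2.
have [hb ba] : h x < b /\ b < a x by rewrite /b; split; lra.
have n2 : nbhs x [set y | b < a y] := pa.1 x (conj U0x W0x) _ (lt_nbhsr ba).
have n3 : nbhs x [set y | h y < b] := ch x _ (lt_nbhsl hb).
have n4 := filterI n1 (filterI n2 n3).
exists (N `&` W0 `&` ([set y | b < a y] `&` [set y | h y < b]))°, a.
split; [exact: open_interior|exact: n4| |].
  apply: cpsh_sub pa => y /interior_subset[[Ny W0y] _].
  by split => //; have [] := NE _ Ny.
move=> y /interior_subset[[Ny W0y] [/= ay hy]]; rewrite /w asboolT//.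
by case: asboolP => // _; apply/max_idPl; lra.
Qed.

End gluing.
End hyperconvex.
End hyperconvex_domain.

(** * Passing to the limit *)

Section boundary_theorem.
Variables (R : realType) (n : nat).
Local Notation V := (Cspace R n).

Lemma psh_o_sub (X Y : set V) (u : V -> R) : X `<=` Y -> psh_o Y u -> psh_o X u.
Proof.
move=> XY [U [v [oU YU pv cv vu]]]; exists U, v; split=> //.
- exact: subset_trans YU.
- by move=> z /XY; exact: vu.
Qed.

(** A Jensen measure for X is one for Y, because it gives full mass to X. *)
Lemma psh_compact_sub (X Y : set V) (u : V -> \bar R) : compact X -> compact Y ->
  X `<=` Y -> psh_compact Y u -> psh_compact X u.
Proof.
move=> cX cY XY [uu su]; split; first exact: usc_on_sub uu.
have hV := @hausdorff_nrm R V.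
have mX := compact_borel hV cX; have mY := compact_borel hV cY.
move=> z Xz mu [reg muX jmu].
have muY : mu Y = 1%E.
  apply/eqP; rewrite eq_le probability_le1//= -muX le_measure ?inE//.
rewrite -(integral_full_measure mX mY XY muX); last exact: usc_on_measurable uu.
apply: su; first exact: XY.
split=> // v pv; rewrite (integral_full_measure mX mY XY muX).
  by apply: jmu; exact: psh_o_sub pv.
by apply: usc_on_measurable => //; apply: continuous_usc_on; exact: psh_o_continuous.
Qed.

Section trunc.
Variables (K : set V) (u : V -> \bar R).
Hypotheses (K0 : K !=set0) (cK : compact K) (uu : usc_on K u).

Definition trunc_below (M : R) (x : V) : R := fine (maxe (u x) (- M)%:E).

Lemma trunc_belowE M x : K x -> (trunc_below M x)%:E = maxe (u x) (- M)%:E.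
Proof.
move=> Kx; have [ux _] := uu Kx; rewrite fineK//.
by case: (u x) ux => [r| |]//= _; rewrite ?maxNye// -EFin_max.
Qed.

Lemma trunc_below_usc M : usc_on K (EFin \o trunc_below M).
Proof.
move=> x Kx; split; first exact: ltry.
move=> a; rewrite /= trunc_belowE// gt_max => /andP[uxa Ma].
have h : nbhs x [set y | K y -> (u y < a%:E)%E] := (uu Kx).2 a uxa.
by apply: filterS h => y h Ky /=; rewrite trunc_belowE// gt_max h.
Qed.

Lemma trunc_below_antitone M M' x : K x -> M <= M' -> trunc_below M' x <= trunc_below M x.
Proof.
move=> Kx MM; rewrite -lee_fin !trunc_belowE// ge_max !le_max lexx/=.
by rewrite lee_fin lerN2 MM orbT.
Qed.

(** A single parameter for the truncation level and the Lipschitz constant makes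
    the sequence decreasing with limit u. *)
Definition regularization (k : nat) : V -> R := sup_conv K (trunc_below k%:R) k%:R.

Let bnd : exists C : R, forall k x, K x -> trunc_below k%:R x <= C.
Proof.
have [C C0 uC] := usc_bounded_above cK uu; exists C => k x Kx.
rewrite -lee_fin trunc_belowE// ge_max uC//= lee_fin.
by apply: le_trans C0; rewrite oppr_le0.
Qed.

Lemma regularization_continuous k : continuous (regularization k).
Proof. by have [C gC] := bnd; exact: sup_conv_continuous (gC k) _ _. Qed.

Lemma regularization_antitone x : {homo regularization ^~ x : i j / (i <= j)%N >-> j <= i}.
Proof.
have [C gC] := bnd.
move=> i j ij; apply: (@le_trans _ _ (sup_conv K (trunc_below i%:R) j%:R x)).
  apply: sup_conv_le => // y Ky.
  apply: le_trans (sup_conv_ge (gC i) _ _ Ky) => //.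
  by rewrite lerD2r trunc_below_antitone// ler_nat.
by apply: (sup_conv_antitone K0 (gC i)); rewrite ?ler_nat.
Qed.

(** Once the truncation level is so low that the truncated function is below b
    at x, Dini's property of its sup-convolutions applies to the set {x}. *)
Lemma regularization_cvg x : K x -> (regularization k x)%:E @[k --> \oo] --> u x.
Proof.
have [C gC] := bnd.
move=> Kx; have ni : nonincreasing_seq (fun k => (regularization k x)%:E).
  by move=> i j ij; rewrite lee_fin regularization_antitone.
have := ereal_nonincreasing_cvgn ni; congr (_ --> _).
apply/eqP; rewrite eq_le; apply/andP; split; last first.
  apply: le_ereal_inf_tmp => _ [k _ <-].
  have h := sup_conv_ge_self (gC k) (ler0n _ k) Kx.
  by apply: (@le_trans _ _ (trunc_below k%:R x)%:E); rewrite ?lee_fin// trunc_belowE// le_max lexx.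
rewrite leNgt; apply/negP => uinf.
have [b ub binf] : exists2 b : R, (u x < b%:E)%E & (b%:E < ereal_inf (range (fun k => (regularization k x)%:E)))%E.
  have : (ereal_inf (range (fun k => (regularization k x)%:E)) < +oo)%E.
    apply: (@le_lt_trans _ _ (regularization 0 x)%:E); last exact: ltry.
    by apply: ereal_inf_lbound; exists 0%N.
  move: uinf; case: (ereal_inf _) => [r| |]//; last by rewrite ltNge leNye.
  case: (u x) => [s| |]//.
    by rewrite lte_fin => sr _; exists ((s + r) / 2); rewrite lte_fin; lra.
  by move=> _ _; exists (r - 1); rewrite ?ltNyr// lte_fin; lra.
pose j := (Num.truncn `|b|).+1.
have jb : - j%:R < b by have := truncnS_gt `|b|; have := ler_norm (- b); rewrite normrN /j; lra.
have [|||||k0 k00 hk0] := @sup_conv_lt R V K (trunc_below j%:R) C K0 (gC j) [set x] (cst b).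
- exact: compact_set1.
- by apply: continuous_subspaceT => y; exact: (@cst_continuous V R b y).
- exact: trunc_below_usc.
- by move=> y ->.
- by move=> y ->; rewrite -lte_fin trunc_belowE// gt_max ub lte_fin.
pose k := maxn j (Num.truncn k0).+1.
have := hk0 k%:R _ x erefl; rewrite ltNge => /(_ _)/negP; apply.
  apply: (le_trans (ltW (truncnS_gt k0))); rewrite ler_nat.
  exact: leq_maxr.
apply: (@le_trans _ _ (regularization k x)); last first.
  apply: sup_conv_le => // y Ky.
  apply: le_trans (sup_conv_ge (gC j) _ _ Ky) => //.
  by rewrite lerD2r trunc_below_antitone// ler_nat leq_maxl.
rewrite -lee_fin ltW// (lt_le_trans binf)//; apply: ereal_inf_lbound.
by exists k.
Qed.

Lemma le_integral_regularization (mu : probability (borel_Cspace R n) R) (a : \bar R) :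
  mu K = 1%E -> (forall k, (a <= \int[mu]_(x in K) (regularization k x)%:E)%E) ->
  (a <= \int[mu]_(x in K) u x)%E.
Proof.
have hV := @hausdorff_nrm R V; have mK := compact_borel hV cK.
move=> muK h; apply: (le_integral_decreasing mK muK) h.
- exact: usc_on_measurable.
- move=> k; apply: continuous_compact_integrable_prob => //.
  exact/continuous_subspaceT/regularization_continuous.
- by move=> x _; exact: regularization_antitone.
- exact: regularization_cvg.
Qed.

End trunc.

(** The hypothesis on the boundary enters through Edwards' duality there: for a
    Jensen measure nu of the boundary, g y <= \int f dnu because u and the
    constant -M both satisfy this inequality. *)
Theorem psh_compact_boundary (Omega : set V) (u : V -> \bar R) :
  P_hyperconvex Omega -> psh Omega u -> usc_on (closure Omega) u ->
  psh_compact (boundary Omega) u -> psh_compact (closure Omega) u.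
Proof.
move=> [oO cO bO [phi [pphi cphi nphi phi0]]] pu uu pB; split => //.
have cK := compact_closure bO; have cB := compact_boundary bO.
have hV := @hausdorff_nrm R V.
have mK := compact_borel hV cK; have mB := compact_borel hV cB.
have BK := @boundary_closure _ _ Omega.
move=> z Kz mu jmu; have [reg muK jmu'] := jmu.
have K0 : closure Omega !=set0 by exists z.
apply: (le_integral_regularization K0 cK uu muK) => k.
set K := closure Omega in K0 *; set g := trunc_below u k%:R; set f := regularization K u k.
have gE x : K x -> (g x)%:E = maxe (u x) (- k%:R)%:E by exact: trunc_belowE.
have [C C0 uC] := usc_bounded_above cK uu.
have gC x : K x -> g x <= C.
  move=> Kx; rewrite -lee_fin gE// ge_max uC//= lee_fin.
  by apply: le_trans C0; rewrite oppr_le0.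
have ug : usc_on K (EFin \o g) by exact: trunc_below_usc.
have k0 : 0 <= k%:R :> R by [].
have cf : continuous f by exact: sup_conv_continuous gC _ k0.
have gf x : K x -> g x <= f x by exact: (sup_conv_ge_self gC).
have ugx x : K x -> (u x <= (g x)%:E)%E by move=> Kx; rewrite gE// le_max lexx.
apply: (le_trans (ugx _ Kz)).
apply/lee_addgt0Pr => e e0.
have e3 : 0 < e / 3 by rewrite divr_gt0.
have [v pv gvf] : exists2 v, psh_o (boundary Omega) v &
    forall x, boundary Omega x -> g x - e / 3 < v x <= f x.
  apply: edwards_uniform => //; first exact: continuous_subspaceT.
    exact: usc_on_sub ug.
  move=> y By nu jnu; have [_ nuB _] := jnu.
  rewrite gE; last exact: BK.
  rewrite ge_max; apply/andP; split.
    apply: (le_trans (pB.2 y By nu jnu)); apply: le_integral_pointwise => x /BK Kx.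
    by apply: (le_trans (ugx _ Kx)); rewrite lee_fin gf.
  rewrite -[leLHS](integral_prob_cst _ mB nuB); apply: le_integral_pointwise => x /BK Kx.
  apply: (@le_trans _ _ (g x)%:E); last by rewrite lee_fin gf.
  by rewrite gE// le_max lexx orbT.
have fC x : K x -> f x <= C.
  move=> _; apply: sup_conv_le => // y Ky.
  by rewrite lerBlDr; apply: le_trans (gC y Ky) _; rewrite lerDl mulr_ge0 ?nrm_ge0.
have [w pw gwf] := psh_o_between oO cO bO pphi cphi nphi phi0 pu ug gE gC cf fC k0
  (fun x _ => lexx _) e3 K0 pv gvf.
have /andP[gw _] := gwf _ Kz.
apply: (@le_trans _ _ (w z)%:E); first by rewrite lee_fin.
apply: (le_trans (jmu' _ pw)).
have fi : mu.-integrable K (EFin \o f).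
  by apply: continuous_compact_integrable_prob => //; exact: continuous_subspaceT.
have ei : mu.-integrable K (fun=> e%:E).
  apply: (@continuous_compact_integrable_prob R V mu K (cst e)) => //.
  by apply: continuous_subspaceT => y; exact: (@cst_continuous V R e y).
rewrite -[X in (_ + X)%E](integral_prob_cst _ mK muK) -integralD//.
apply: le_integral_pointwise => x Kx; rewrite -EFinD lee_fin.
by have /andP[_] := gwf _ Kx; lra.
Qed.

End boundary_theorem.

Theorem theorem5 (R : realType) (n : nat) (Omega : set (Cspace R n))
    (u : Cspace R n -> \bar R) :
  P_hyperconvex Omega ->
  psh Omega u ->
  usc_on (closure Omega) u ->
  (psh_compact (closure Omega) u <-> psh_compact (boundary Omega) u).
Proof.
move=> hO pu uu; split; last exact: psh_compact_boundary.
have [_ _ bO _] := hO; have cK := compact_closure bO.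
by apply: psh_compact_sub cK _; [exact: compact_boundary|exact: boundary_closure].
Qed.
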